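(* Suppose $\Omega\subset\mathbb{R}^n$ is a bounded quasihyperbolically well behaved domain and $\Omega'\subset\mathbb{R}^n$ is a bounded QH-visibility domain. Let $\mu\ge0$. Then every continuous $(1,\mu)$-quasihyperbolic quasi-isometric embedding $f:(\Omega,k_\Omega)\to(\Omega',k_{\Omega'})$ extends to a continuous map $F:\overline{\Omega}^{Euc}\to\overline{\Omega'}^{Euc}$.
   Context: For a domain $\Omega\subsetneq\mathbb{R}^n$, $\partial_{Euc}\Omega$ and $\overline{\Omega}^{Euc}$ are its Euclidean boundary and closure, and $\delta_\Omega(x)=d_{Euc}(x,\partial_{Euc}\Omega)$. The quasihyperbolic metric is $k_\Omega(x,y)=\inf_\gamma\int_\gamma\frac{|dx|}{\delta_\Omega(x)}$, the infimum over rectifiable curves in $\Omega$ joining $x$ and $y$; $(\Omega,k_\Omega)$ is a complete, proper, geodesic metric space, and a quasihyperbolic geodesic is a geodesic of $(\Omega,k_\Omega)$. For a curve $\gamma$, $k_\Omega(x_0,\gamma)$ denotes the $k_\Omega$-distance from $x_0$ to the image of $\gamma$. A map $f:(\Omega,k_\Omega)\to(\Omega',k_{\Omega'})$ is a $(1,\mu)$-quasihyperbolic quasi-isometric embedding if $k_\Omega(x,y)-\mu\le k_{\Omega'}(f(x),f(y))\le k_\Omega(x,y)+\mu$ for all $x,y\in\Omega$. A bounded domain $\Omega\subset\mathbb{R}^n$ is quasihyperbolically well behaved if, whenever $\{x_k\},\{y_k\}$ are sequences in $\Omega$ with $\lim_{k}x_k=\lim_k y_k=p\in\partial_{Euc}\Omega$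 and $\gamma_k:[a_k,b_k]\to\Omega$ is a sequence of quasihyperbolic geodesics joining $x_k$ and $y_k$, one has $\lim_{k\to\infty}k_\Omega(x_0,\gamma_k)=\infty$ for some (hence all) $x_0\in\Omega$. A bounded domain $\Omega$ is a QH-visibility domain if for every pair $p,q\in\partial_{Euc}\Omega$, $p\neq q$, there exist neighborhoods $U$ of $p$ and $V$ of $q$ in $\mathbb{R}^n$ with $\overline U\cap\overline V=\emptyset$ and a compact set $K\subset\Omega$ such that every quasihyperbolic geodesic $\gamma:[0,T]\to\Omega$ with $\gamma(0)\in U$ and $\gamma(T)\in V$ satisfies $\gamma([0,T])\cap K\neq\emptyset$. *)

(* Defs.v *)
From HB Require Import structures.
From mathcomp Require Import all_boot all_order all_algebra.
From mathcomp Require Import all_classical all_reals all_analysis.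
Import Order.TTheory GRing.Theory Num.Theory.
Import numFieldNormedType.Exports.

Set Implicit Arguments.
Unset Strict Implicit.
Unset Printing Implicit Defensive.

Local Open Scope classical_set_scope.
Local Open Scope ring_scope.

(* R^n is 'rV[R]_n.  The library norm on 'rV[R]_n is the sup norm: it yields
   the Euclidean topology and bounded sets, but distances and lengths of curves
   have to be measured with the Euclidean distance defined here. *)
Definition euc_dist (R : realType) (n : nat) (x y : 'rV[R]_n) : R :=
  Num.sqrt (\sum_(i < n) (x 0 i - y 0 i) ^+ 2).

Definition bounded_domain (R : realType) (n : nat) (Omega : set 'rV[R]_n) :
    Prop :=
  [/\ open Omega, connected Omega, Omega !=set0 & bounded_set Omega].

Definition euc_boundary (R : realType) (n : nat) (Omega : set 'rV[R]_n) :
    set 'rV[R]_n :=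
  closure Omega `\` interior Omega.

Definition bdist (R : realType) (n : nat) (Omega : set 'rV[R]_n)
    (x : 'rV[R]_n) : R :=
  inf [set euc_dist x z | z in euc_boundary Omega].

(* [s] lists the points of the subdivision of [a, b] that follow [a]. *)
Definition polygonal_length (R : realType) (n : nat) (gamma : R -> 'rV[R]_n)
    (a : R) (s : seq R) : R :=
  \sum_(i < size s)
    euc_dist (gamma (nth a (a :: s) i)) (gamma (nth a (a :: s) i.+1)).

Definition curve_length (R : realType) (n : nat) (gamma : R -> 'rV[R]_n)
    (a b : R) : \bar R :=
  ereal_sup [set (polygonal_length gamma a s)%:E | s in itv_partition a b].

Definition rectifiable_curve (R : realType) (n : nat) (Omega : set 'rV[R]_n)
    (x y : 'rV[R]_n) (gamma : R -> 'rV[R]_n) (a b : R) : Prop :=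
  [/\ a <= b, {within `[a, b], continuous gamma},
      (forall t, t \in `[a, b] -> Omega (gamma t)),
      gamma a = x /\ gamma b = y & (curve_length gamma a b < +oo)%E].

(* The point at arc length [l] from the initial point, for a rectifiable curve
   and 0 <= l <= curve_length gamma a b; the first parameter at which the
   length reaches [l] is used, [gamma] being constant wherever the length is. *)
Definition arc_length_param (R : realType) (n : nat) (gamma : R -> 'rV[R]_n)
    (a b l : R) : 'rV[R]_n :=
  gamma (inf [set t | t \in `[a, b] /\ (l%:E <= curve_length gamma a t)%E]).

Definition line_integral (R : realType) (n : nat) (rho : 'rV[R]_n -> R)
    (gamma : R -> 'rV[R]_n) (a b : R) : \bar R :=
  (\int[@lebesgue_measure R]_(l in `[0%R, fine (curve_length gamma a b)])
     (rho (arc_length_param gamma a b l))%:E)%E.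

(* For x, y in a bounded domain the infimum is finite, so that [fine] only
   matters outside of the domain. *)
Definition qh_dist (R : realType) (n : nat) (Omega : set 'rV[R]_n)
    (x y : 'rV[R]_n) : R :=
  fine (ereal_inf
    [set v | exists gamma a b, rectifiable_curve Omega x y gamma a b /\
       v = line_integral (fun z => (bdist Omega z)^-1) gamma a b]).

Definition qh_geodesic (R : realType) (n : nat) (Omega : set 'rV[R]_n)
    (gamma : R -> 'rV[R]_n) (a b : R) : Prop :=
  [/\ a <= b, (forall t, t \in `[a, b] -> Omega (gamma t)) &
      forall s t, s \in `[a, b] -> t \in `[a, b] ->
        qh_dist Omega (gamma s) (gamma t) = `|s - t| ].

Definition qh_dist_curve (R : realType) (n : nat) (Omega : set 'rV[R]_n)
    (x0 : 'rV[R]_n) (gamma : R -> 'rV[R]_n) (a b : R) : R :=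
  inf [set qh_dist Omega x0 (gamma t) | t in `[a, b]].

Definition qh_well_behaved (R : realType) (n : nat) (Omega : set 'rV[R]_n) :
    Prop :=
  forall (x y : nat -> 'rV[R]_n) (p : 'rV[R]_n)
         (gamma : nat -> R -> 'rV[R]_n) (a b : nat -> R),
    (forall k, Omega (x k)) -> (forall k, Omega (y k)) ->
    euc_boundary Omega p ->
    x k @[k --> \oo] --> p -> y k @[k --> \oo] --> p ->
    (forall k, [/\ qh_geodesic Omega (gamma k) (a k) (b k),
                   gamma k (a k) = x k & gamma k (b k) = y k]) ->
    exists2 x0, Omega x0 &
      qh_dist_curve Omega x0 (gamma k) (a k) (b k) @[k --> \oo] --> +oo.

Definition qh_visibility (R : realType) (n : nat) (Omega : set 'rV[R]_n) :
    Prop :=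
  forall p q, euc_boundary Omega p -> euc_boundary Omega q -> p <> q ->
    exists U V K : set 'rV[R]_n,
      [/\ nbhs p U, nbhs q V, closure U `&` closure V = set0,
          compact K /\ K `<=` Omega &
          forall (gamma : R -> 'rV[R]_n) (T : R),
            qh_geodesic Omega gamma 0 T -> U (gamma 0) -> V (gamma T) ->
            [set gamma t | t in `[0, T]] `&` K !=set0].

Definition qh_quasi_isometric_embedding (R : realType) (n : nat) (mu : R)
    (Omega Omega' : set 'rV[R]_n) (f : 'rV[R]_n -> 'rV[R]_n) : Prop :=
  (forall x, Omega x -> Omega' (f x)) /\
  forall x y, Omega x -> Omega y ->
    qh_dist Omega x y - mu <= qh_dist Omega' (f x) (f y) <=
    qh_dist Omega x y + mu.

Definition qh_continuous (R : realType) (n : nat)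
    (Omega Omega' : set 'rV[R]_n) (f : 'rV[R]_n -> 'rV[R]_n) : Prop :=
  forall x, Omega x -> forall e : R, 0 < e ->
    exists2 d : R, 0 < d &
      forall y, Omega y -> qh_dist Omega x y < d ->
        qh_dist Omega' (f x) (f y) < e.

(* Main.v *)
Require Import Defs.
From HB Require Import structures.
From mathcomp Require Import all_boot all_order all_algebra.
From mathcomp Require Import all_classical all_reals all_analysis.
From mathcomp Require Import measurable_realfun ring lra.
Import Order.TTheory GRing.Theory Num.Theory.
Import numFieldNormedType.Exports.
Local Open Scope classical_set_scope.
Local Open Scope ring_scope.

Set Implicit Arguments.
Unset Strict Implicit.
Unset Printing Implicit Defensive.

(** Let [x_k] and [y_k] converge to the same boundary point [p] of [Omega], and
    suppose that [f x_k] and [f y_k] converge to different points [xi], [eta] of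
    the closure of [Omega'].  Since [f] distorts distances by at most [mu],
    points escaping to infinity in the quasihyperbolic metric of [Omega] are
    mapped to points escaping to infinity, so [xi] and [eta] are boundary
    points.  Join [x_k] to [y_k] by a quasihyperbolic geodesic [g_k].  Its image
    is a connected curve, hence contains a point [w_k] at Euclidean distance
    [r = |xi - eta| / 2] from [xi] ([euc_dist_crossing]); a limit [zeta] of the
    [w_k] differs from both [xi] and [eta].  As [Omega] is well behaved, [g_k]
    leaves every bounded set, so [w_k] does, and [zeta] is a boundary point.
    Write [d] for the distance of [Omega'] and fix a base point [o].  Visibility
    between two distinct boundary points bounds Gromov products near them
    ([qh_visibility_product]):
      [d (f x_k) w_k >= d o (f x_k) + d o w_k - C] and
      [d w_k (f y_k) >= d o w_k + d o (f y_k) - C].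
    On the other hand [w_k] lies on the image of a geodesic, so up to [3 mu] the
    sum of the two left-hand sides is at most [d (f x_k) (f y_k)], hence at most
    [d o (f x_k) + d o (f y_k)].  Therefore [d o w_k] stays bounded, which is
    absurd ([qh_embedding_cauchy]).  So [f] satisfies Cauchy's criterion at
    every boundary point and extends by taking limits ([continuous_extension]).

    This needs the quasihyperbolic distance to be a finite metric compatible
    with the Euclidean topology, bounded on compact sets, infinite at the
    boundary, and geodesic.  All of it follows from a description that avoids
    integrals: [x] and [y] are at distance at most [T] exactly when some path
    [h] on [[0, T]] goes from [x] to [y] in [Omega] with
      [|h s - h t| <= delta (h s) * (e ^ |s - t| - 1)] for all [s] and [t],
    where [delta] is the distance to the boundary ([qh_path]).  This condition
    is the integrated form of [|h'| <= delta h].  It is symmetric in time,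
    stable under concatenation, and closed under pointwise limits, so that by
    compactness of the closure of [Omega] the least [T] is attained
    ([qh_reach_attained]), and a path attaining it is a geodesic.

    That the infimum of the line integrals is this least [T] ([qh_distE]) is
    proved by cutting curves in small pieces.  The arc length parametrization
    of a rectifiable curve is 1-Lipschitz, and each of its short pieces can be
    travelled in a time at most [(1 + e)] times the integral of [1 / delta] over
    the piece ([qh_time_le_integral]).  Conversely a path as above is a
    rectifiable curve whose length on [[s, t]] is at most
    [delta (h s) * (e ^ (t - s) - 1)], so that the integral of [1 / delta] along
    it exceeds [T] by an arbitrarily small proportion
    ([line_integral_qh_path]). *)

(** * Euclidean distance and topology *)

(** The quadratic polynomial [\sum_i (a i - t * b i) ^+ 2] in [t] is nonnegative
    at its minimum [t = (\sum_i a i * b i) / (\sum_i b i ^+ 2)]. *)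
Lemma sum_Cauchy_Schwarz (R : realType) (n : nat) (a b : 'I_n -> R) :
  (\sum_i a i * b i) ^+ 2 <= (\sum_i a i ^+ 2) * (\sum_i b i ^+ 2).
Proof.
have B0 : 0 <= \sum_i b i ^+ 2 by apply: sumr_ge0 => i _; exact: sqr_ge0.
have quad t : 0 <= \sum_i a i ^+ 2 - t *+ 2 * (\sum_i a i * b i)
                   + t ^+ 2 * (\sum_i b i ^+ 2).
  rewrite !mulr_sumr -sumrB -big_split /=; apply: sumr_ge0 => i _.
  by have := sqr_ge0 (a i - t * b i); congr (0 <= _); ring.
have [B_eq0|B_neq0] := eqVneq (\sum_i b i ^+ 2) 0.
  have b0 i : b i = 0.
    apply/eqP; rewrite -sqrf_eq0.
    move/eqP: B_eq0; rewrite psumr_eq0; last by move=> j _; exact: sqr_ge0.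
    by move=> /allP /(_ i (mem_index_enum i)) /implyP; apply.
  by rewrite [X in X ^+ 2]big1 ?B_eq0 ?mulr0 ?expr0n// => i _; rewrite b0 mulr0.
have := quad ((\sum_i a i * b i) / (\sum_i b i ^+ 2)).
have B_gt0 : 0 < \sum_i b i ^+ 2 by rewrite lt_neqAle eq_sym B_neq0.
rewrite -(pmulr_lge0 _ B_gt0); set A := \sum_i a i ^+ 2.
set B := \sum_i b i ^+ 2 in B_neq0 *; set C := \sum_i _.
have -> : (A - (C / B) *+ 2 * C + (C / B) ^+ 2 * B) * B = A * B - C ^+ 2.
  by field.
by rewrite subr_ge0.
Qed.

Lemma euc_dist_ge0 (R : realType) (n : nat) (x y : 'rV[R]_n) :
  0 <= euc_dist x y.
Proof. exact: sqrtr_ge0. Qed.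

Lemma euc_distxx (R : realType) (n : nat) (x : 'rV[R]_n) : euc_dist x x = 0.
Proof.
by rewrite /euc_dist big1 ?sqrtr0// => i _; rewrite subrr expr0n.
Qed.

Lemma euc_distC (R : realType) (n : nat) (x y : 'rV[R]_n) :
  euc_dist x y = euc_dist y x.
Proof.
by rewrite /euc_dist; congr Num.sqrt; apply: eq_bigr => i _; ring.
Qed.

Lemma euc_dist_triangle (R : realType) (n : nat) (y x z : 'rV[R]_n) :
  euc_dist x z <= euc_dist x y + euc_dist y z.
Proof.
have ge0_ss (u : 'I_n -> R) : 0 <= \sum_i u i ^+ 2.
  by apply: sumr_ge0 => i _; exact: sqr_ge0.
rewrite -(ler_pXn2r (n := 2)) ?nnegrE ?addr_ge0 ?euc_dist_ge0//.
rewrite sqrrD /euc_dist !sqr_sqrtr//.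
have -> : \sum_(i < n) (x 0 i - z 0 i) ^+ 2 =
    \sum_i (x 0 i - y 0 i) ^+ 2
    + (\sum_i (x 0 i - y 0 i) * (y 0 i - z 0 i)) *+ 2
    + \sum_i (y 0 i - z 0 i) ^+ 2.
  by rewrite -sumrMnl -!big_split /=; apply: eq_bigr => i _; ring.
rewrite lerD2r lerD2l lerMn2r /= -sqrtrM//.
apply: le_trans (ler_norm _) _.
by rewrite -sqrtr_sqr ler_sqrt ?mulr_ge0// sum_Cauchy_Schwarz.
Qed.

Lemma euc_dist_lipschitz (R : realType) (n : nat) (x x' y y' : 'rV[R]_n) :
  `|euc_dist x y - euc_dist x' y'| <= euc_dist x x' + euc_dist y y'.
Proof.
have h1 := euc_dist_triangle x' x y; have h2 := euc_dist_triangle y' x' y.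
have h3 := euc_dist_triangle x x' y'; have h4 := euc_dist_triangle y x y'.
rewrite (euc_distC y' y) in h2; rewrite (euc_distC x' x) in h3.
by rewrite ler_norml; apply/andP; split; lra.
Qed.

Lemma norm_le_euc_dist (R : realType) (n : nat) (x y : 'rV[R]_n) :
  `|x - y| <= euc_dist x y.
Proof.
rewrite /Num.Def.normr /= mx_normrE; apply: bigmax_le; first exact: euc_dist_ge0.
move=> [i j] _ /=; rewrite ord1 !mxE -sqrtr_sqr /euc_dist ler_sqrt.
  rewrite (bigD1 j)//= lerDl; apply: sumr_ge0 => k _; exact: sqr_ge0.
by apply: sumr_ge0 => k _; exact: sqr_ge0.
Qed.

Lemma euc_dist_le_norm (R : realType) (n : nat) (x y : 'rV[R]_n) :
  euc_dist x y <= n%:R * `|x - y|.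
Proof.
have nv0 : 0 <= n%:R * `|x - y| by rewrite mulr_ge0.
rewrite -[leRHS]ger0_norm// -sqrtr_sqr /euc_dist ler_sqrt ?sqr_ge0//.
have coord i : (x 0 i - y 0 i) ^+ 2 <= `|x - y| ^+ 2.
  rewrite -real_normK ?num_real// ler_pXn2r ?nnegrE//.
  have -> : x 0 i - y 0 i = (x - y) 0 i by rewrite !mxE.
  rewrite {2}/Num.Def.normr /= mx_normrE.
  exact: (le_bigmax_cond _ (fun ij : 'I_1 * 'I_n => `|(x - y) ij.1 ij.2|)
           (j := (0, i))).
apply: le_trans (ler_sum _ (fun i _ => coord i)) _.
rewrite sumr_const card_ord -[leLHS]mulr_natl exprMn ler_wpM2r ?sqr_ge0//.
by rewrite -natrX ler_nat; case: n {x y nv0 coord} => // n; rewrite leq_pmulr.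
Qed.

Lemma euc_dist_eq0 (R : realType) (n : nat) (x y : 'rV[R]_n) :
  euc_dist x y = 0 -> x = y.
Proof.
move=> xy0; apply/eqP; rewrite -subr_eq0 -normr_le0 -xy0.
exact: norm_le_euc_dist.
Qed.

(** The topology of the row vectors comes from the sup norm; it is Euclidean
    because [norm_le_euc_dist] and [euc_dist_le_norm] compare the two norms. *)
Lemma nbhs_euc_distP (R : realType) (n : nat) (x : 'rV[R]_n)
    (A : set 'rV[R]_n) :
  nbhs x A <-> exists2 e : R, 0 < e & forall y, euc_dist x y < e -> A y.
Proof.
split=> [/nbhs_ballP[e e0 eA]|[e e0 eA]].
  exists e => // y xy; apply: eA; rewrite mx_norm_ball /ball_ /=.
  exact: le_lt_trans (norm_le_euc_dist _ _) xy.
apply/nbhs_ballP; exists (e / n.+1%:R) => /=; first by rewrite divr_gt0.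
move=> y; rewrite mx_norm_ball /ball_ /= ltr_pdivlMr// => xy; apply: eA.
apply: le_lt_trans (euc_dist_le_norm x y) _; apply: le_lt_trans xy.
by rewrite mulrC ler_wpM2l// ler_nat.
Qed.

Lemma cvg_euc_dist0P (R : realType) (n : nat) (T : Type) (F : set_system T)
    {FF : Filter F} (u : T -> 'rV[R]_n) (l : 'rV[R]_n) :
  u @ F --> l <-> forall e : R, 0 < e -> \forall t \near F, euc_dist l (u t) < e.
Proof.
split=> [ul e e0|ul A /nbhs_euc_distP[e e0 eA]].
  by apply: (ul [set y | euc_dist l y < e]); apply/nbhs_euc_distP; exists e.
rewrite /nbhs /= /fmap /=; near=> t.
by apply: eA; near: t; exact: ul.
Unshelve. all: by end_near. Qed.

Lemma cvg_euc_dist (R : realType) (n : nat) (T : Type) (F : set_system T)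
    {FF : Filter F} (u v : T -> 'rV[R]_n) (x y : 'rV[R]_n) :
  u @ F --> x -> v @ F --> y -> euc_dist (u t) (v t) @[t --> F] --> euc_dist x y.
Proof.
move=> /cvg_euc_dist0P ux /cvg_euc_dist0P vy; apply/cvgrPdist_lt => e e0.
near=> t; apply: le_lt_trans (euc_dist_lipschitz _ _ _ _) _.
rewrite [e]splitr ltrD//; near: t; [apply: ux|apply: vy]; exact: divr_gt0.
Unshelve. all: by end_near. Qed.

Lemma closure_euc_distP (R : realType) (n : nat) (A : set 'rV[R]_n) x :
  closure A x <-> forall e : R, 0 < e -> exists2 y, A y & euc_dist x y < e.
Proof.
split=> [Ax e e0|Ax B /nbhs_euc_distP[e e0 eB]].
  have [|y [Ay xy]] := Ax [set y | euc_dist x y < e]; last by exists y.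
  by apply/nbhs_euc_distP; exists e.
by have [y Ay xy] := Ax e e0; exists y; split=> //; exact: eB.
Qed.

Lemma euc_dist_segment (R : realType) (n : nat) (x y : 'rV[R]_n) (s t : R) :
  euc_dist (x + s *: (y - x)) (x + t *: (y - x)) = `|s - t| * euc_dist x y.
Proof.
rewrite -sqrtr_sqr -sqrtrM ?sqr_ge0//; congr Num.sqrt; rewrite mulr_sumr.
by apply: eq_bigr => i _; rewrite !mxE; ring.
Qed.

(** * Distance to the boundary *)

Lemma open_euc_dist (R : realType) (n : nat) (A : set 'rV[R]_n) x :
  open A -> A x -> exists2 e : R, 0 < e & forall y, euc_dist x y < e -> A y.
Proof. by move=> oA Ax; apply/nbhs_euc_distP; exact: open_nbhs_nbhs. Qed.

(** The first point of the segment outside of [Omega] is a boundary point: it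
    is not in [Omega] because [Omega] is open, and it is a limit of points that
    precede it. *)
Lemma euc_boundary_segment (R : realType) (n : nat) (Omega : set 'rV[R]_n) x y :
  open Omega -> Omega x -> ~ Omega y ->
  exists2 t : R, 0 <= t <= 1 & euc_boundary Omega (x + t *: (y - x)).
Proof.
move=> oO Ox nOy; pose p (t : R) := x + t *: (y - x).
(* The summand 1 makes D positive without a case analysis on x = y. *)
pose D := euc_dist x y + 1.
have D0 : 0 < D by rewrite ltr_wpDl// euc_dist_ge0.
have dp s t : euc_dist (p s) (p t) <= `|s - t| * D.
  by rewrite euc_dist_segment ler_wpM2l// lerDl.
pose S := [set t : R | 0 <= t <= 1 /\ ~ Omega (p t)].
have S1 : S 1.
  split; first by rewrite ler01 lexx.
  by rewrite /p scale1r addrC subrK.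
have iS : has_inf S by split; [exists 1|exists 0 => t [/andP[]]].
have t0_ge0 : 0 <= inf S.
  by apply: lb_le_inf; [exists 1|move=> t [/andP[]]].
have t0_le1 : inf S <= 1 by apply: ge_inf => //; case: iS.
exists (inf S); first by rewrite t0_ge0.
rewrite -/(p (inf S)); split.
  apply/closure_euc_distP => e e0.
  have [t0_eq0|t0_neq0] := eqVneq (inf S) 0.
    by exists x => //; rewrite /p t0_eq0 scale0r addr0 euc_distxx.
  have t0_gt0 : 0 < inf S by rewrite lt_neqAle eq_sym t0_neq0.
  pose t := Num.max 0 (inf S - e / D / 2).
  have eD0 : 0 < e / D / 2 by rewrite !divr_gt0.
  have t_lt : t < inf S by rewrite gt_max t0_gt0 ltrBlDr ltrDl.
  have t_ge0 : 0 <= t by rewrite le_max lexx.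
  exists (p t).
    apply: contrapT => nOt.
    have : inf S <= t.
      by apply: ge_inf; [case: iS|split=> //; rewrite t_ge0 (le_trans (ltW t_lt))].
    by rewrite leNgt t_lt.
  apply: le_lt_trans (dp _ _) _; rewrite -ltr_pdivlMr// ger0_norm ?subr_ge0 ?ltW//.
  apply: (@le_lt_trans _ _ (e / D / 2)); last by rewrite ltr_pdivrMr ?ltr_pMr ?divr_gt0// ltr1n.
  by rewrite lerBlDl -lerBlDr le_max lexx orbT.
rewrite (interior_id _).1// => Ot0.
have [e e0 eO] : exists2 e : R, 0 < e & forall y, euc_dist (p (inf S)) y < e -> Omega y.
  exact: open_euc_dist.
have [t [t01 nOt] t_lt] := inf_adherent (divr_gt0 e0 D0) iS.
have t0t : inf S <= t by apply: ge_inf; [exact: iS.2|split].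
apply: nOt; apply: eO; apply: le_lt_trans (dp _ _) _; rewrite -ltr_pdivlMr//.
by rewrite distrC ger0_norm ?subr_ge0// ltrBlDl.
Qed.

(** Without a boundary point [bdist] would be the infimum of the empty set,
    which is 0.  For [n = 0] the space is a single point and has no proper
    nonempty open subset, hence the assumption on [n]. *)
Lemma bounded_domain_boundary_neq0 (R : realType) (n : nat)
    (Omega : set 'rV[R]_n) :
  (0 < n)%N -> bounded_domain Omega -> euc_boundary Omega !=set0.
Proof.
move=> n0 [oO _ [x Ox] /(@ex_bound _ _ _ _ (globally Omega) (globally_properfilter Ox))[M bM]].
pose y : 'rV[R]_n := const_mx (M + 1).
have nOy : ~ Omega y.
  move=> /bM; apply/negP; rewrite -ltNge.
  apply: (@lt_le_trans _ _ (M + 1)); first by rewrite ltrDl.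
  apply: le_trans (ler_norm _) _.
  have -> : `|M + 1| = `|y 0 (Ordinal n0)| by rewrite mxE.
  rewrite {2}/Num.Def.normr /= mx_normrE.
  exact: (le_bigmax_cond _ (fun ij : 'I_1 * 'I_n => `|y ij.1 ij.2|)
           (j := (0, Ordinal n0))).
by have [t _ bt] := euc_boundary_segment oO Ox nOy; exists (x + t *: (y - x)).
Qed.

Lemma bdist_le (R : realType) (n : nat) (Omega : set 'rV[R]_n) x z :
  euc_boundary Omega z -> bdist Omega x <= euc_dist x z.
Proof.
move=> bz; apply: ge_inf; last by exists z.
by exists 0 => _ [w _ <-]; exact: euc_dist_ge0.
Qed.

Lemma le_bdist (R : realType) (n : nat) (Omega : set 'rV[R]_n) x (c : R) :
  euc_boundary Omega !=set0 ->
  (forall z, euc_boundary Omega z -> c <= euc_dist x z) -> c <= bdist Omega x.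
Proof.
move=> [z bz] cz; apply: lb_le_inf; first by exists (euc_dist x z), z.
by move=> _ [w bw <-]; exact: cz.
Qed.

Lemma bdist_lipschitz (R : realType) (n : nat) (Omega : set 'rV[R]_n) x y :
  euc_boundary Omega !=set0 -> bdist Omega x <= bdist Omega y + euc_dist x y.
Proof.
move=> b0; rewrite -lerBlDr; apply: le_bdist => // z bz.
by rewrite lerBlDl; apply: le_trans (bdist_le _ bz) (euc_dist_triangle _ _ _).
Qed.

Lemma bdist_boundary (R : realType) (n : nat) (Omega : set 'rV[R]_n) x :
  euc_boundary Omega x -> bdist Omega x = 0.
Proof.
move=> bx; apply/eqP; rewrite eq_le; apply/andP; split.
  by rewrite -[leRHS](euc_distxx x); exact: bdist_le.
by apply: le_bdist; [exists x|move=> z _; exact: euc_dist_ge0].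
Qed.

Lemma bdist_gt0 (R : realType) (n : nat) (Omega : set 'rV[R]_n) x :
  open Omega -> euc_boundary Omega !=set0 -> Omega x -> 0 < bdist Omega x.
Proof.
move=> oO b0 Ox.
have [e e0 eO] : exists2 e : R, 0 < e & forall y, euc_dist x y < e -> Omega y.
  exact: open_euc_dist.
apply: lt_le_trans e0 _; apply: le_bdist => // z [_ nz].
rewrite leNgt; apply/negP => /eO Oz; apply: nz.
by rewrite (interior_id _).1.
Qed.

(** A segment that leaves [Omega] first meets the boundary, at a distance at
    least [bdist Omega x]. *)
Lemma bdist_ball (R : realType) (n : nat) (Omega : set 'rV[R]_n) x y :
  open Omega -> Omega x -> euc_dist x y < bdist Omega x -> Omega y.
Proof.
move=> oO Ox xy; apply: contrapT => nOy.
have [t /andP[t0 t1] bt] := euc_boundary_segment oO Ox nOy.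
have := bdist_le x bt; apply/negP; rewrite -ltNge; apply: le_lt_trans xy.
have := euc_dist_segment x y 0 t; rewrite scale0r addr0 => ->.
by rewrite sub0r normrN ger0_norm// ler_piMl ?euc_dist_ge0.
Qed.

(** Keeps limits of points of [Omega] inside [Omega], as soon as the distance
    to the boundary is bounded below along the sequence. *)
Lemma closure_bdist_gt0 (R : realType) (n : nat) (Omega : set 'rV[R]_n) x :
  open Omega -> closure Omega x -> 0 < bdist Omega x -> Omega x.
Proof.
move=> oO Ox dx; apply: contrapT => nOx.
move: dx; rewrite bdist_boundary ?ltxx//; split=> //.
by rewrite (interior_id _).1.
Qed.

Lemma cvg_bdist (R : realType) (n : nat) (Omega : set 'rV[R]_n) (T : Type)
    (F : set_system T) {FF : Filter F} (u : T -> 'rV[R]_n) x :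
  euc_boundary Omega !=set0 -> u @ F --> x ->
  bdist Omega (u t) @[t --> F] --> bdist Omega x.
Proof.
move=> b0 /cvg_euc_dist0P ux; apply/cvgrPdist_lt => e e0.
near=> t; apply: (@le_lt_trans _ _ (euc_dist x (u t))); last first.
  by near: t; exact: ux.
have h1 := bdist_lipschitz x (u t) b0; have h2 := bdist_lipschitz (u t) x b0.
rewrite (euc_distC (u t)) in h2; rewrite ler_norml; apply/andP; split; lra.
Unshelve. all: by end_near. Qed.

Lemma bdist_comp_continuous (R : realType) (n : nat) (Omega : set 'rV[R]_n)
    (g : R -> 'rV[R]_n) (A : set R) :
  euc_boundary Omega !=set0 -> {within A, continuous g} ->
  {within A, continuous (fun l => bdist Omega (g l))}.
Proof.
move=> b0 /subspace_continuousP gc; apply/subspace_continuousP => x Ax.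
by apply: cvg_bdist => //; exact: gc.
Qed.

(** * Auxiliary facts on exponentials and compactness *)

Lemma expR_sub1_small (R : realType) (M e : R) :
  0 < M -> 0 < e ->
  exists2 k : R, 0 < k & forall u, u <= k -> M * (expR u - 1) < e.
Proof.
move=> M0 e0; exists (ln (1 + e / M / 2)) => [|u].
  by rewrite ln_gt0// ltrDl !divr_gt0.
rewrite -ler_expR lnK ?posrE ?addr_gt0 ?divr_gt0// => ue.
apply: (@le_lt_trans _ _ (M * (e / M / 2))); first by rewrite ler_wpM2l ?(ltW M0)// lerBlDl.
by rewrite (_ : M * _ = e / 2); [lra|field; rewrite gt_eqF].
Qed.

(** Removes the factor [1 + e] left by cutting a curve in small pieces. *)
Lemma le_of_le_mul_gt1 (R : realType) (x y : R) :
  0 <= y -> (forall c : R, 1 < c -> x <= c * y) -> x <= y.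
Proof.
move=> y0 xy; apply/ler_addgt0Pr => e e0.
have y1 : 0 < y + 1 by rewrite ltr_wpDl.
apply: le_trans (xy (1 + e / (y + 1)) _) _; first by rewrite ltrDl divr_gt0.
rewrite mulrDl mul1r lerD2l -mulrAC ler_pdivrMr// ler_wpM2l ?(ltW e0)//.
by rewrite lerDl.
Qed.

(** Limits along an ultrafilter replace the extraction of subsequences: a single
    ultrafilter serves for uncountably many sequences at once. *)
Lemma ultra_fmap_compact (I : Type) (T : topologicalType) (U : set_system I)
    (u : I -> T) (A : set T) :
  UltraFilter U -> compact A -> (forall i, A (u i)) ->
  exists2 l, A l & u @ U --> l.
Proof.
move=> UU; rewrite compact_ultra => cA uA.
have UP : ProperFilter U by exact: ultra_proper.
have UF : UltraFilter (u @ U).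
  apply: Build_UltraFilter => G GP UG.
  apply/seteqP; split=> [B GB|]; last exact: UG.
  have [//|UnB] := in_ultra_setVsetC (u @^-1` B) UU.
  have GnB : G (~` B) by apply: UG.
  have G0 : G set0 by rewrite -(setICr B); exact: filterI.
  by have := @filter_not_empty _ G GP G0.
have [|l [Al ul]] := cA (u @ U) UF; last by exists l.
by apply: (@filterE _ U) => i; exact: uA.
Qed.

Lemma closure_bounded_compact (R : realType) (n : nat) (Omega : set 'rV[R]_n) :
  bounded_domain Omega -> compact (closure Omega).
Proof.
move=> [_ _ [x Ox] /(@ex_bound _ _ _ _ (globally Omega)
  (globally_properfilter Ox))[M bM]].
apply: bounded_closed_compact; last exact: closed_closure.
apply/(@ex_bound _ _ _ _ (globally (closure Omega))
  (globally_properfilter (subset_closure Ox))).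
exists (M + 1) => y /closure_euc_distP/(_ 1 ltr01)[z Oz yz].
rewrite -(subrK z y); apply: le_trans (ler_normD _ _) _; rewrite addrC lerD//.
  exact: bM.
by apply: le_trans (norm_le_euc_dist _ _) (ltW yz).
Qed.

(** * Paths of unit quasihyperbolic speed *)

(** The inequality is the integrated form of [|h'| <= bdist Omega h], i.e. of
    quasihyperbolic speed at most 1; equivalently,
    [ln (1 + |h s - h t| / bdist Omega (h s)) <= |s - t|].  It is required for
    [s <= t] and [t <= s] alike, which makes it invariant under time
    reversal. *)
Definition qh_path (R : realType) (n : nat) (Omega : set 'rV[R]_n)
    (h : R -> 'rV[R]_n) (T : R) : Prop :=
  (forall t, 0 <= t <= T -> Omega (h t)) /\
  forall s t, 0 <= s <= T -> 0 <= t <= T ->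
    euc_dist (h s) (h t) <= bdist Omega (h s) * (expR `|s - t| - 1).

Definition qh_reach (R : realType) (n : nat) (Omega : set 'rV[R]_n)
    (x y : 'rV[R]_n) (T : R) : Prop :=
  0 <= T /\ exists h, [/\ qh_path Omega h T, h 0 = x & h T = y].

(** The quasihyperbolic distance, in the form of a least travel time; see
    [qh_distE]. *)
Definition qh_time (R : realType) (n : nat) (Omega : set 'rV[R]_n)
    (x y : 'rV[R]_n) : R :=
  inf [set T | qh_reach Omega x y T].

(** The distance to the boundary grows at most exponentially in time.  This
    keeps paths away from the boundary, and bounds the distance from below
    near the boundary. *)
Lemma bdist_le_expR (R : realType) (n : nat) (Omega : set 'rV[R]_n)
    (x y : 'rV[R]_n) (u : R) :
  euc_boundary Omega !=set0 ->
  euc_dist x y <= bdist Omega x * (expR u - 1) ->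
  bdist Omega y <= bdist Omega x * expR u.
Proof.
move=> b0 xy; have := bdist_lipschitz y x b0; rewrite euc_distC; lra.
Qed.

(** The function [ln (1 + |x - y| / bdist Omega x)] satisfies the triangle
    inequality: moving from [x] to [y] multiplies [bdist] by at most [expR u].
    This is what allows two paths to be concatenated. *)
Lemma euc_dist_le_expR_trans (R : realType) (n : nat) (Omega : set 'rV[R]_n)
    (x y z : 'rV[R]_n) (u v : R) :
  euc_boundary Omega !=set0 -> 0 <= v ->
  euc_dist x y <= bdist Omega x * (expR u - 1) ->
  euc_dist y z <= bdist Omega y * (expR v - 1) ->
  euc_dist x z <= bdist Omega x * (expR (u + v) - 1).
Proof.
move=> b0 v0 xy yz; apply: le_trans (euc_dist_triangle y _ _) _.
have ev : 0 <= expR v - 1 by rewrite subr_ge0 -expR0 ler_expR.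
have := ler_wpM2r ev (bdist_le_expR b0 xy); rewrite expRD.
by move: xy yz; lra.
Qed.

Lemma qh_path_sub (R : realType) (n : nat) (Omega : set 'rV[R]_n)
    (h : R -> 'rV[R]_n) (T s t : R) :
  qh_path Omega h T -> 0 <= s -> s <= t -> t <= T ->
  qh_reach Omega (h s) (h t) (t - s).
Proof.
move=> [hO hh] s0 st tT; split; first by rewrite subr_ge0.
exists (fun u => h (s + u)); split; last 2 first.
- by rewrite addr0.
- by rewrite addrC subrK.
split=> [u /andP[u0 us]|u v /andP[u0 us] /andP[v0 vs]].
  by apply: hO; apply/andP; split; lra.
apply: le_trans (hh _ _ _ _) _; try by apply/andP; split; lra.
by rewrite (_ : s + u - (s + v) = u - v) //; ring.
Qed.

Lemma qh_reachC (R : realType) (n : nat) (Omega : set 'rV[R]_n)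
    (x y : 'rV[R]_n) (T : R) :
  qh_reach Omega x y T -> qh_reach Omega y x T.
Proof.
move=> [T0 [h [[hO hh] hx hy]]]; split=> //; exists (fun t => h (T - t)).
split; last 2 first.
- by rewrite subr0.
- by rewrite subrr.
split=> [t /andP[t0 tT]|s t /andP[s0 sT] /andP[t0 tT]].
  by apply: hO; apply/andP; split; lra.
apply: le_trans (hh _ _ _ _) _; try by apply/andP; split; lra.
by rewrite (_ : T - s - (T - t) = - (s - t)) ?normrN//; ring.
Qed.

Lemma qh_reachxx (R : realType) (n : nat) (Omega : set 'rV[R]_n)
    (x : 'rV[R]_n) :
  Omega x -> qh_reach Omega x x 0.
Proof.
move=> Ox; split=> //; exists (fun=> x); split=> //; split=> // s t sT tT.
by rewrite euc_distxx -(le_anti sT) -(le_anti tT) subrr normr0 expR0 subrr mulr0.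
Qed.

Lemma qh_reach_trans (R : realType) (n : nat) (Omega : set 'rV[R]_n)
    (x y z : 'rV[R]_n) (S T : R) :
  euc_boundary Omega !=set0 ->
  qh_reach Omega x y S -> qh_reach Omega y z T -> qh_reach Omega x z (S + T).
Proof.
move=> b0 [S0 [g [[gO gg] gx gy]]] [T0 [h [[hO hh] hy hz]]].
split; first exact: addr_ge0.
exists (fun t => if t <= S then g t else h (t - S)); split; last 2 first.
- by rewrite S0.
- case: ifPn => [ST|_]; last by rewrite addrC addKr.
  have T_eq0 : T = 0 by lra.
  by rewrite T_eq0 addr0 gy -hy -hz T_eq0.
have gS s : 0 <= s <= S ->
    euc_dist (g s) y <= bdist Omega (g s) * (expR (S - s) - 1).
  move=> /andP[s0 sS]; rewrite -gy; apply: le_trans (gg _ _ _ _) _.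
  - by rewrite s0.
  - by rewrite S0 lexx.
  - by rewrite distrC ger0_norm ?subr_ge0.
have Sg s : 0 <= s <= S -> euc_dist y (g s) <= bdist Omega y * (expR (S - s) - 1).
  move=> /andP[s0 sS]; rewrite -gy; apply: le_trans (gg _ _ _ _) _.
  - by rewrite S0 lexx.
  - by rewrite s0.
  - by rewrite ger0_norm ?subr_ge0.
have hT s : 0 <= s <= T -> euc_dist (h s) y <= bdist Omega (h s) * (expR s - 1).
  move=> /andP[s0 sT]; rewrite -hy; apply: le_trans (hh _ _ _ _) _.
  - by rewrite s0.
  - by rewrite T0 lexx.
  - by rewrite subr0 ger0_norm.
have Th s : 0 <= s <= T -> euc_dist y (h s) <= bdist Omega y * (expR s - 1).
  move=> /andP[s0 sT]; rewrite -hy; apply: le_trans (hh _ _ _ _) _.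
  - by rewrite T0 lexx.
  - by rewrite s0.
  - by rewrite sub0r normrN ger0_norm.
split=> [t /andP[t0 tT]|s t /andP[s0 sT] /andP[t0 tT]].
  case: ifPn => [tS|]; first by apply: gO; rewrite t0.
  by rewrite -ltNge => St; apply: hO; apply/andP; split; lra.
case: ifPn => [sS|]; case: ifPn => [tS|].
- by apply: gg; rewrite ?s0 ?t0.
- rewrite -ltNge => St.
  have -> : `|s - t| = (S - s) + (t - S).
    by rewrite distrC ger0_norm; [ring|lra].
  apply: (euc_dist_le_expR_trans b0) (gS _ _) (Th _ _); first by lra.
  + by rewrite s0.
  + by apply/andP; split; lra.
- rewrite -ltNge => Ss.
  have -> : `|s - t| = (s - S) + (S - t) by rewrite ger0_norm; [ring|lra].
  apply: (euc_dist_le_expR_trans b0) (hT _ _) (Sg _ _); first by lra.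
  + by apply/andP; split; lra.
  + by rewrite t0.
- rewrite -!ltNge => St Ss; apply: le_trans (hh _ _ _ _) _.
  + by apply/andP; split; lra.
  + by apply/andP; split; lra.
  + by rewrite (_ : s - S - (t - S) = s - t) //; ring.
Qed.

(** The segment is travelled at the constant Euclidean speed
    [bdist Omega x - euc_dist x y], which is a lower bound of [bdist Omega] on
    the segment. *)
Lemma qh_reach_ball (R : realType) (n : nat) (Omega : set 'rV[R]_n)
    (x y : 'rV[R]_n) :
  open Omega -> euc_boundary Omega !=set0 -> Omega x ->
  euc_dist x y < bdist Omega x ->
  qh_reach Omega x y (euc_dist x y / (bdist Omega x - euc_dist x y)).
Proof.
move=> oO b0 Ox xy; set r := euc_dist x y; set c := bdist Omega x - r.
have c0 : 0 < c by rewrite subr_gt0.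
have r0 : 0 <= r := euc_dist_ge0 x y.
split; first by rewrite divr_ge0// ltW.
pose h t := x + (t * c / r) *: (y - x).
have hh s t : euc_dist (h s) (h t) <= `|s - t| * c.
  rewrite euc_dist_segment -/r.
  have [->|r_neq0] := eqVneq r 0; first by rewrite mulr0 mulr_ge0// ltW.
  rewrite -mulrBl -mulrBl !normrM (gtr0_norm c0) normfV (ger0_norm r0).
  by rewrite mulfVK.
have xh t : 0 <= t <= r / c -> euc_dist x (h t) <= r.
  move=> /andP[t0 tT]; have := hh 0 t.
  rewrite {1}/h !mul0r scale0r addr0 sub0r normrN ger0_norm// => /le_trans.
  by apply; rewrite -ler_pdivlMr.
exists h; split; last 2 first.
- by rewrite /h !mul0r scale0r addr0.
- have [r_eq0|r_neq0] := eqVneq r 0.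
    by rewrite /h r_eq0 !mul0r scale0r addr0; exact: euc_dist_eq0.
  by rewrite /h divfK ?gt_eqF// divff// scale1r addrC subrK.
split=> [t tT|s t sT tT].
  by apply: (bdist_ball oO Ox); apply: le_lt_trans (xh _ tT) xy.
apply: le_trans (hh s t) _; rewrite mulrC ler_pM// ?(ltW c0)//.
  have := bdist_lipschitz x (h s) b0; have := xh _ sT; rewrite /c; lra.
by rewrite lerBrDl expR_ge1Dx.
Qed.

(** The points that can be reached from [x] form a subset of [Omega] that is
    open and relatively closed, because [qh_reach_ball] applies around every
    point. *)
Lemma qh_reach_connected (R : realType) (n : nat) (Omega : set 'rV[R]_n)
    (x y : 'rV[R]_n) :
  open Omega -> connected Omega -> euc_boundary Omega !=set0 ->
  Omega x -> Omega y -> exists T, qh_reach Omega x y T.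
Proof.
move=> oO cO b0 Ox Oy.
pose B := [set z | Omega z /\ exists T, qh_reach Omega x z T].
have reach_near z w : Omega z -> euc_dist z w < bdist Omega z ->
    exists T, qh_reach Omega z w T.
  by move=> Oz zw; eexists; exact: qh_reach_ball.
have oB : open B.
  rewrite openE => z [Oz [T zT]]; apply/nbhs_euc_distP.
  exists (bdist Omega z) => [|w zw]; first exact: bdist_gt0.
  split; first exact: bdist_ball Oz zw.
  have [S zwS] := reach_near _ _ Oz zw; exists (T + S).
  exact: qh_reach_trans zT zwS.
have oC : open [set z | Omega z /\ ~ exists T, qh_reach Omega x z T].
  rewrite openE => z [Oz nz]; apply/nbhs_euc_distP.
  exists (bdist Omega z) => [|w zw]; first exact: bdist_gt0.
  split; first exact: bdist_ball Oz zw.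
  move=> [T xw]; apply: nz; have [S zwS] := reach_near _ _ Oz zw.
  by exists (T + S); apply: qh_reach_trans xw (qh_reachC zwS).
suff BE : B = Omega by move: Oy; rewrite -{1}BE => -[].
apply: cO.
- by exists x; split=> //; exists 0; exact: qh_reachxx.
- by exists B => //; rewrite setIidr// => z [].
- exists (~` [set z | Omega z /\ ~ exists T, qh_reach Omega x z T]).
    exact: open_closedC.
  apply/seteqP; split=> z.
    by move=> [Oz rz]; split=> // -[].
  by move=> [Oz /not_andP[//|/contrapT]].
Qed.

(** A limit of nearly optimal paths, taken pointwise along an ultrafilter on the
    compact closure of [Omega], is an optimal path: the inequality defining
    [qh_path] involves only continuous functions of the end points, and it keeps
    the limit at a positive distance from the boundary. *)
Lemma qh_reach_attained (R : realType) (n : nat) (Omega : set 'rV[R]_n)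
    (x y : 'rV[R]_n) :
  bounded_domain Omega -> euc_boundary Omega !=set0 -> Omega x -> Omega y ->
  qh_reach Omega x y (qh_time Omega x y).
Proof.
move=> dO b0 Ox Oy; have [oO cO _ _] := dO.
have [T1 xyT1] := qh_reach_connected oO cO b0 Ox Oy.
have iS : has_inf [set T | qh_reach Omega x y T].
  by split; [exists T1|exists 0 => T []].
set T := qh_time Omega x y.
have T0 : 0 <= T by apply: lb_le_inf => [|S []//]; exists T1.
have apx N : exists hS : (R -> 'rV[R]_n) * R,
    [/\ qh_path Omega hS.1 hS.2, hS.1 0 = x, hS.1 hS.2 = y,
        T <= hS.2 & hS.2 < T + N.+1%:R^-1].
  have N0 : 0 < N.+1%:R^-1 :> R by rewrite invr_gt0.
  have [S Sr ST] := inf_adherent N0 iS.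
  have TS : T <= S by apply: ge_inf => //; exact: iS.2.
  by have [S0 [h [hp hx hy]]] := Sr; exists (h, S).
have {apx}[hS hSP] := choice apx.
pose h N := (hS N).1; pose S N := (hS N).2.
have [U [UU oU]] := ultraFilterLemma eventually_filter.
have UP : ProperFilter U by exact: ultra_proper.
have cK := closure_bounded_compact dO.
have dom t N : 0 <= t <= T -> 0 <= t <= S N.
  by move=> /andP[-> tT] /=; apply: le_trans tT _; have [] := hSP N.
have lim t : exists l, 0 <= t <= T ->
    closure Omega l /\ (fun N => h N t) @ U --> l.
  have [tT|ntT] := boolP (0 <= t <= T); last by exists x.
  have [|l Ol hl] := ultra_fmap_compact (u := fun N => h N t) UU cK.
    move=> N; apply: subset_closure; have [[hO _] _ _ _ _] := hSP N.
    by apply: hO; exact: dom.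
  by exists l.
have {lim}[g gP] := choice lim.
have gg s t : 0 <= s <= T -> 0 <= t <= T ->
    euc_dist (g s) (g t) <= bdist Omega (g s) * (expR `|s - t| - 1).
  move=> sT tT; have [_ gs] := gP s sT; have [_ gt] := gP t tT.
  have rhs : bdist Omega (h N s) * (expR `|s - t| - 1) @[N --> U] -->
      bdist Omega (g s) * (expR `|s - t| - 1).
    by apply: cvgM (cvg_cst _); exact: cvg_bdist.
  apply: (ler_cvg_to (cvg_euc_dist gs gt) rhs).
  near=> N; have [[_ hh] _ _ _ _] := hSP N.
  by apply: hh; exact: dom.
have T00 : 0 <= (0 : R) <= T by rewrite lexx.
have TT : 0 <= T <= T by rewrite lexx T0.
have gx : g 0 = x.
  have [_ g0] := gP 0 T00.
  have h0 : (fun N => h N 0) @ U --> x.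
    have hx0 N : h N 0 = x by have [] := hSP N.
    by rewrite (funext hx0); exact: cvg_cst.
  exact: cvg_unique g0 h0.
have gO t : 0 <= t <= T -> Omega (g t).
  move=> tT; have [Ot _] := gP t tT.
  apply: closure_bdist_gt0 => //.
  have := bdist_le_expR b0 (gg _ _ tT T00); rewrite gx.
  by move=> /(lt_le_trans (bdist_gt0 oO b0 Ox)); rewrite pmulr_lgt0// expR_gt0.
split=> //; exists g; split=> //.
have [_ gT] := gP T TT.
have hT : (fun N => h N T) @ U --> y.
  apply/cvg_euc_dist0P => e e0; apply: oU.
  have dy := bdist_gt0 oO b0 Oy.
  have [k k0 ke] := expR_sub1_small (bdist_gt0 oO b0 Oy) e0.
  near=> N; have [[_ hh] _ hy TS ST] := hSP N.
  have -> : y = h N (S N) by [].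
  apply: le_lt_trans (hh _ _ _ _) _.
  - by rewrite lexx andbT (le_trans T0).
  - by rewrite T0.
  - rewrite hy; apply: ke; rewrite ger0_norm ?subr_ge0// lerBlDl.
    apply: le_trans (ltW ST) _; rewrite lerD2l; apply: ltW.
    by near: N; exact: (near_infty_natSinv_lt (PosNum k0)).
exact: cvg_unique gT hT.
Unshelve. all: by end_near. Qed.

Lemma qh_timeP (R : realType) (n : nat) (Omega : set 'rV[R]_n) x y T :
  qh_reach Omega x y T -> qh_time Omega x y <= T.
Proof. by move=> xyT; apply: ge_inf => //; exists 0 => S []. Qed.

Lemma qh_time_ge0 (R : realType) (n : nat) (Omega : set 'rV[R]_n) x y :
  0 <= qh_time Omega x y.
Proof.
rewrite /qh_time; have [->|/set0P S0] := eqVneq [set T | qh_reach Omega x y T] set0.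
  by rewrite inf0.
by apply: lb_le_inf => // T [].
Qed.

Lemma qh_timexx (R : realType) (n : nat) (Omega : set 'rV[R]_n) x :
  Omega x -> qh_time Omega x x = 0.
Proof.
move=> Ox; apply/eqP; rewrite eq_le qh_time_ge0 andbT.
by apply: qh_timeP; exact: qh_reachxx.
Qed.

Lemma qh_timeC (R : realType) (n : nat) (Omega : set 'rV[R]_n) x y :
  qh_time Omega x y = qh_time Omega y x.
Proof.
by congr inf; apply/seteqP; split=> T; exact: qh_reachC.
Qed.

(** Times add up along a concatenation, and both infima are attained. *)
Lemma qh_time_triangle (R : realType) (n : nat) (Omega : set 'rV[R]_n) y x z :
  bounded_domain Omega -> euc_boundary Omega !=set0 ->
  Omega x -> Omega y -> Omega z ->
  qh_time Omega x z <= qh_time Omega x y + qh_time Omega y z.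
Proof.
move=> dO b0 Ox Oy Oz; apply: qh_timeP.
by apply: (qh_reach_trans b0 (y := y)); exact: qh_reach_attained.
Qed.

(** * Length of curves and arc length parametrization *)

Lemma within_continuous_euc_distP (R : realType) (n : nat)
    (V : pseudoMetricType R) (A : set V) (g : V -> 'rV[R]_n) :
  {within A, continuous g} <->
  forall x, A x -> forall e : R, 0 < e ->
    exists2 d : R, 0 < d &
      forall y, A y -> ball x d y -> euc_dist (g x) (g y) < e.
Proof.
split=> [/subspace_continuousP gc x Ax e e0|gc].
  have /cvg_euc_dist0P/(_ e e0) := gc x Ax.
  rewrite /prop_near1 /within /= => /nbhs_ballP[d /= d0 dg].
  by exists d => // y Ay xy; exact: dg.
apply/subspace_continuousP => x Ax; apply/cvg_euc_dist0P => e e0.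
have [d d0 dg] := gc x Ax e e0.
by apply/nbhs_ballP; exists d => //= y xy Ay; exact: dg.
Qed.

Lemma polygonal_length_nil (R : realType) (n : nat) (g : R -> 'rV[R]_n) a :
  polygonal_length g a [::] = 0.
Proof. by rewrite /polygonal_length big_ord0. Qed.

Lemma polygonal_length_cons (R : realType) (n : nat) (g : R -> 'rV[R]_n) a t s :
  polygonal_length g a (t :: s) = euc_dist (g a) (g t) + polygonal_length g t s.
Proof.
rewrite /polygonal_length /= big_ord_recl /=; congr (_ + _).
apply: eq_bigr => i _; congr (euc_dist (g _) (g _)) => /=.
  by apply: (set_nth_default t (s := t :: s)); rewrite /= ltnS ltnW// ltn_ord.
by apply: set_nth_default; rewrite ltn_ord.
Qed.

Lemma itv_partition_consP (R : realType) (a b t : R) s :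
  itv_partition a b (t :: s) -> a < t /\ itv_partition t b s.
Proof. by move=> [/= /andP[at_ ts] lb]; split. Qed.

Lemma itv_partition_cons_lt (R : realType) (a b t : R) s :
  a < t -> itv_partition t b s -> itv_partition a b (t :: s).
Proof. by move=> at_ [ts lb]; split=> //=; rewrite at_. Qed.

Lemma itv_partition_ends_le (R : realType) (a b : R) s :
  itv_partition a b s -> a <= b.
Proof.
elim: s a => [a [_ /= /eqP ->]//|t s IH a /itv_partition_consP[at_ /IH]].
exact/le_trans/ltW.
Qed.

Lemma le_curve_length (R : realType) (n : nat) (g : R -> 'rV[R]_n) a b s :
  itv_partition a b s -> ((polygonal_length g a s)%:E <= curve_length g a b)%E.
Proof. by move=> sab; apply: ereal_sup_ubound; exists s. Qed.

Lemma curve_length_le (R : realType) (n : nat) (g : R -> 'rV[R]_n) a b M :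
  (forall s, itv_partition a b s -> ((polygonal_length g a s)%:E <= M)%E) ->
  (curve_length g a b <= M)%E.
Proof. by move=> gM; apply/ereal_supP => _ [s sab <-]; exact: gM. Qed.

Lemma euc_dist_le_curve_length (R : realType) (n : nat) (g : R -> 'rV[R]_n) a b :
  a <= b -> ((euc_dist (g a) (g b))%:E <= curve_length g a b)%E.
Proof.
rewrite le_eqVlt => /predU1P[->|ab].
  by rewrite euc_distxx -(polygonal_length_nil g b); exact: le_curve_length.
have := @le_curve_length _ _ g a b [:: b].
rewrite polygonal_length_cons polygonal_length_nil addr0; apply.
exact: itv_partition_cons_lt.
Qed.

Lemma curve_length_ge0 (R : realType) (n : nat) (g : R -> 'rV[R]_n) a b :
  a <= b -> (0 <= curve_length g a b)%E.
Proof.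
move/(euc_dist_le_curve_length g); apply: le_trans.
by rewrite lee_fin euc_dist_ge0.
Qed.

(** Prepending a point to a partition. *)
Lemma euc_distD_curve_length (R : realType) (n : nat) (g : R -> 'rV[R]_n) a b c :
  a <= b -> b <= c ->
  ((euc_dist (g a) (g b))%:E + curve_length g b c <= curve_length g a c)%E.
Proof.
rewrite le_eqVlt => /predU1P[->|ab bc].
  by rewrite euc_distxx add0e.
rewrite addeC -leeBrDr//; apply: curve_length_le => s sbc.
rewrite leeBrDr// -EFinD addrC -polygonal_length_cons.
by apply: le_curve_length; exact: itv_partition_cons_lt.
Qed.

(** Appending a point to a partition.  The second term is a real number, so that
    it can be moved across the inequality whether or not the length is finite. *)
Lemma curve_lengthD_euc_dist (R : realType) (n : nat) (g : R -> 'rV[R]_n) a b c :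
  b <= c ->
  (curve_length g a b + (euc_dist (g b) (g c))%:E <= curve_length g a c)%E.
Proof.
move=> bc; rewrite -leeBrDr//; apply: curve_length_le => s.
rewrite leeBrDr//; elim: s a => [|t s IH] a.
  move=> [_ /= /eqP ->].
  by rewrite polygonal_length_nil add0e; exact: euc_dist_le_curve_length.
move=> /itv_partition_consP[at_ stb].
rewrite polygonal_length_cons EFinD -addeA.
apply: le_trans (leeD2l _ (IH _ stb)) _.
apply: euc_distD_curve_length; first exact: ltW.
exact: le_trans (itv_partition_ends_le stb) bc.
Qed.

Lemma curve_length_mono (R : realType) (n : nat) (g : R -> 'rV[R]_n) a b c :
  b <= c -> (curve_length g a b <= curve_length g a c)%E.
Proof.
move=> bc; apply: le_trans (curve_lengthD_euc_dist g a bc).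
by rewrite leeDl// lee_fin euc_dist_ge0.
Qed.

(** A partition of [[a, c]] is refined by inserting [b], which can only increase
    the polygonal length. *)
Lemma curve_length_triangle (R : realType) (n : nat) (g : R -> 'rV[R]_n) a b c :
  a <= b -> b <= c ->
  (curve_length g a c <= curve_length g a b + curve_length g b c)%E.
Proof.
move=> ab bc; apply: curve_length_le => s; elim: s a ab => [|t s IH] a ab.
  move=> [_ /= /eqP ac]; rewrite polygonal_length_nil.
  by rewrite adde_ge0// curve_length_ge0.
move=> /itv_partition_consP[at_ stc]; rewrite polygonal_length_cons EFinD.
have [bt|/ltW tb] := leP b t.
  apply: (@le_trans _ _ ((euc_dist (g a) (g b))%:E +
      ((euc_dist (g b) (g t))%:E + curve_length g t c))%E).
    rewrite addeA -[X in (_ <= X + _)%E]EFinD leeD//; last exact: le_curve_length.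
    by rewrite lee_fin; exact: euc_dist_triangle.
  apply: leeD; first exact: euc_dist_le_curve_length.
  exact: euc_distD_curve_length (itv_partition_ends_le stc).
apply: le_trans (leeD2l _ (IH _ tb stc)) _; rewrite addeA leeD2r//.
by apply: euc_distD_curve_length => //; exact: ltW.
Qed.

(** The parameter at which [arc_length_param] evaluates the curve. *)
Definition arc_length_time (R : realType) (n : nat) (g : R -> 'rV[R]_n)
    (a b l : R) : R :=
  inf [set t | t \in `[a, b] /\ (l%:E <= curve_length g a t)%E].

Lemma arc_length_paramE (R : realType) (n : nat) (g : R -> 'rV[R]_n) a b l :
  arc_length_param g a b l = g (arc_length_time g a b l).
Proof. by []. Qed.

Lemma has_inf_arc_length_time (R : realType) (n : nat) (g : R -> 'rV[R]_n)
    a b l :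
  a <= b -> (l%:E <= curve_length g a b)%E ->
  has_inf [set t | t \in `[a, b] /\ (l%:E <= curve_length g a t)%E].
Proof.
move=> ab lL; split; first by exists b; rewrite /= in_itv /= ab lexx.
by exists a => t [/= + _]; rewrite in_itv /= => /andP[].
Qed.

Lemma arc_length_time_itv (R : realType) (n : nat) (g : R -> 'rV[R]_n) a b l :
  a <= b -> (l%:E <= curve_length g a b)%E -> arc_length_time g a b l \in `[a, b].
Proof.
move=> ab lL; have [S0 Sb] := has_inf_arc_length_time ab lL.
rewrite in_itv /=; apply/andP; split.
  by apply: lb_le_inf => // t [/= + _]; rewrite in_itv /= => /andP[].
by apply: ge_inf => //; rewrite /= in_itv /= ab lexx.
Qed.

Lemma arc_length_time_le (R : realType) (n : nat) (g : R -> 'rV[R]_n) a b l t :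
  t \in `[a, b] -> (l%:E <= curve_length g a t)%E ->
  arc_length_time g a b l <= t.
Proof.
move=> tab lt; apply: ge_inf => //.
by exists a => u [/= + _]; rewrite in_itv /= => /andP[].
Qed.

Lemma arc_length_time_ge (R : realType) (n : nat) (g : R -> 'rV[R]_n) a b l t :
  a <= b -> (l%:E <= curve_length g a b)%E ->
  (curve_length g a t < l%:E)%E -> t <= arc_length_time g a b l.
Proof.
move=> ab lL tl; have [S0 Sb] := has_inf_arc_length_time ab lL.
apply: lb_le_inf => // u [/= _ lu]; rewrite leNgt; apply/negP => /ltW ut.
by have := curve_length_mono g a ut; rewrite leNgt (lt_le_trans tl lu).
Qed.

Lemma arc_length_time_mono (R : realType) (n : nat) (g : R -> 'rV[R]_n)
    a b l m :
  a <= b -> l <= m -> (m%:E <= curve_length g a b)%E ->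
  arc_length_time g a b l <= arc_length_time g a b m.
Proof.
move=> ab lm mL; have [S0 Sb] := has_inf_arc_length_time ab mL.
apply: lb_le_inf => // t [/= tab mt]; apply: arc_length_time_le => //.
by apply: le_trans mt; rewrite lee_fin.
Qed.

Lemma arc_length_param0 (R : realType) (n : nat) (g : R -> 'rV[R]_n) a b :
  a <= b -> arc_length_param g a b 0 = g a.
Proof.
move=> ab; rewrite arc_length_paramE; congr g; apply/eqP; rewrite eq_le.
have := arc_length_time_itv ab (curve_length_ge0 g ab).
rewrite in_itv /= => /andP[-> _]; rewrite andbT.
apply: arc_length_time_le; first by rewrite in_itv /= lexx.
exact: curve_length_ge0.
Qed.

(** The infimum defining [arc_length_time] is approached from the right by
    parameters at which the length is at least [l]. *)
Lemma arc_length_time_approx (R : realType) (n : nat) (g : R -> 'rV[R]_n)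
    a b l (c e : R) :
  a <= b -> {within `[a, b], continuous g} -> (l%:E <= curve_length g a b)%E ->
  arc_length_time g a b l < c -> 0 < e ->
  exists t, [/\ t \in `[a, b], t < c, (l%:E <= curve_length g a t)%E
    & euc_dist (arc_length_param g a b l) (g t) < e].
Proof.
move=> ab /within_continuous_euc_distP gc lL tc e0.
have tI := arc_length_time_itv ab lL.
have [d d0 dg] := gc _ tI e e0.
have m0 : 0 < Num.min d (c - arc_length_time g a b l).
  by rewrite lt_min d0 subr_gt0.
have [t [tab lt] tm] := inf_adherent m0 (has_inf_arc_length_time ab lL).
rewrite -/(arc_length_time g a b l) -ltrBlDl lt_min in tm.
case/andP: tm => td tc'; exists t; split=> //.
  by rewrite ltrD2r in tc'.
apply: dg => //; rewrite /ball /= distrC ger0_norm ?subr_ge0//.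
exact: arc_length_time_le.
Qed.

(** If the two parameters differ, the first point is a limit from the right of
    points at length at least [l], the second one a limit from the left of points
    at length less than [m], and the length between such points is less than
    [m - l].  Only the curve has to be continuous for this, not its length. *)
Lemma arc_length_param_lipschitz (R : realType) (n : nat) (g : R -> 'rV[R]_n)
    a b l m :
  a <= b -> {within `[a, b], continuous g} -> l <= m ->
  (m%:E <= curve_length g a b)%E ->
  euc_dist (arc_length_param g a b l) (arc_length_param g a b m) <= m - l.
Proof.
move=> ab gc lm mL.
have lL : (l%:E <= curve_length g a b)%E by apply: le_trans mL; rewrite lee_fin.
have := arc_length_time_mono ab lm mL; rewrite le_eqVlt => /predU1P[tt|tt].
  by rewrite !arc_length_paramE tt euc_distxx subr_ge0.
apply/ler_addgt0Pr => e e0.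
have e2 : 0 < e / 2 by rewrite divr_gt0.
have [t [tab t_lt lt dt]] := arc_length_time_approx ab gc lL tt e2.
have mI := arc_length_time_itv ab mL.
have /within_continuous_euc_distP/(_ _ mI _ e2)[d d0 dg] := gc.
pose u := Num.max t (arc_length_time g a b m - d / 2).
have u_lt : u < arc_length_time g a b m.
  by rewrite gt_max t_lt /= ltrBlDr ltrDl divr_gt0.
have tu : t <= u by rewrite le_max lexx.
have uab : u \in `[a, b].
  move: tab mI; rewrite !in_itv /= => /andP[at_ _] /andP[_ mb].
  by rewrite (le_trans at_ tu) (le_trans (ltW u_lt) mb).
have du : euc_dist (arc_length_param g a b m) (g u) < e / 2.
  apply: dg => //; rewrite /ball /= ger0_norm ?subr_ge0 ?(ltW u_lt)//.
  have : arc_length_time g a b m - d / 2 <= u by rewrite le_max lexx orbT.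
  lra.
have ul : (curve_length g a u < m%:E)%E.
  rewrite ltNge; apply/negP => /(arc_length_time_le uab).
  by rewrite leNgt u_lt.
have tul : euc_dist (g t) (g u) <= m - l.
  rewrite lerBrDl -lee_fin EFinD; apply: le_trans (ltW ul).
  by apply: le_trans (curve_lengthD_euc_dist g a tu); rewrite leeD2r.
have h1 := euc_dist_triangle (g t) (arc_length_param g a b l)
  (arc_length_param g a b m).
have h2 := euc_dist_triangle (g u) (g t) (arc_length_param g a b m).
rewrite (euc_distC (g u)) in h2; lra.
Qed.

(** The length may reach its final value before [b]; the curve is constant from
    that parameter on. *)
Lemma arc_length_param_end (R : realType) (n : nat) (g : R -> 'rV[R]_n) a b :
  a <= b -> {within `[a, b], continuous g} -> (curve_length g a b < +oo)%E ->
  arc_length_param g a b (fine (curve_length g a b)) = g b.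
Proof.
move=> ab gc Lfin; set L := fine _.
have LE : curve_length g a b = L%:E.
  by rewrite fineK// ge0_fin_numE// curve_length_ge0.
have LL : (L%:E <= curve_length g a b)%E by rewrite LE.
have := arc_length_time_itv ab LL; rewrite in_itv /= => /andP[_].
rewrite le_eqVlt => /predU1P[tb|tb]; first by rewrite arc_length_paramE tb.
apply: euc_dist_eq0; apply/eqP; rewrite eq_le euc_dist_ge0 andbT.
apply/ler_addgt0Pr => e e0; rewrite add0r.
have [t [tab _ Lt dt]] := arc_length_time_approx ab gc LL tb e0.
have t_b : t <= b by move: tab; rewrite in_itv /= => /andP[].
have : euc_dist (g t) (g b) <= 0.
  rewrite -lee_fin -(leeD2lE (x := L%:E))// adde0 -{2}LE.
  by apply: le_trans (curve_lengthD_euc_dist g a t_b); rewrite leeD2r.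
have := euc_dist_triangle (g t) (arc_length_param g a b L) (g b); lra.
Qed.

(** * Integrals over intervals and the lower bound for line integrals *)

Lemma qh_density_measurable (R : realType) (n : nat) (Omega : set 'rV[R]_n)
    (g : R -> 'rV[R]_n) (A : set R) :
  measurable A -> open Omega -> euc_boundary Omega !=set0 ->
  {within A, continuous g} -> (forall l, A l -> Omega (g l)) ->
  measurable_fun A (fun l => ((bdist Omega (g l))^-1)%:E).
Proof.
move=> mA oO b0 gc gO; apply/measurable_EFinP.
apply: subspace_continuous_measurable_fun => //.
apply/subspace_continuousP => x Ax; apply: cvgV.
  by rewrite gt_eqF// bdist_gt0//; exact: gO.
exact: (subspace_continuousP _ _).1 (bdist_comp_continuous b0 gc) x Ax.
Qed.

Lemma ge0_integral_itv_split (R : realType) (phi : R -> \bar R) (u v L : R) :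
  measurable_fun `[0, L] phi -> (forall l, l \in `[0, L] -> (0 <= phi l)%E) ->
  0 <= u -> u <= v -> v <= L ->
  (\int[lebesgue_measure]_(l in `[0%R, v]) phi l =
   \int[lebesgue_measure]_(l in `[0%R, u]) phi l +
   \int[lebesgue_measure]_(l in `]u, v]) phi l)%E.
Proof.
move=> mphi phi0 u0 uv vL.
have vE : `[0, v]%classic = `[0, u]%classic `|` `]u, v]%classic :> set R.
  by rewrite -itv_bndbnd_setU// bnd_simp.
have vsub : `[0, v]%classic `<=` `[0, L]%classic.
  by move=> l /=; rewrite !in_itv /= => /andP[-> /le_trans]; exact.
rewrite vE ge0_integral_setU//.
- by rewrite -vE; exact: measurable_funS mphi.
- by rewrite -vE => l /vsub; exact: phi0.
- apply/disj_setPS => l /= []; rewrite !in_itv /= => /andP[_ lu] /andP[ul _].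
  by move: ul; rewrite ltNge lu.
Qed.

Lemma ge0_integral_itv_le (R : realType) (phi : R -> \bar R) (u v M : R) :
  measurable_fun `]u, v] phi -> (forall l, l \in `]u, v] -> (0 <= phi l)%E) ->
  u <= v -> 
  (forall l, l \in `]u, v] -> (phi l <= M%:E)%E) ->
  (\int[lebesgue_measure]_(l in `]u, v]) phi l <= (M * (v - u))%:E)%E.
Proof.
move=> mphi phi0 uv phiM.
apply: (@le_trans _ _ (\int[lebesgue_measure]_(l in `]u, v]) cst M%:E l)%E).
  by apply: ge0_le_integral => //; exact: measurable_cst.
rewrite integral_cst//= lebesgue_measure_itv/= lte_fin.
case: ltP => [_|vu]; first by rewrite -EFinB -EFinM.
by rewrite (@le_anti _ _ u v) ?uv// subrr mule0 mulr0.
Qed.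

Lemma ge0_le_integral_itv (R : realType) (phi : R -> \bar R) (u v M : R) :
  measurable_fun `]u, v] phi -> 0 <= M -> u <= v ->
  (forall l, l \in `]u, v] -> (M%:E <= phi l)%E) ->
  ((M * (v - u))%:E <= \int[lebesgue_measure]_(l in `]u, v]) phi l)%E.
Proof.
move=> mphi M0 uv phiM.
apply: (@le_trans _ _ (\int[lebesgue_measure]_(l in `]u, v]) cst M%:E l)%E).
  rewrite integral_cst//= lebesgue_measure_itv/= lte_fin.
  case: ltP => [_|vu]; first by rewrite -EFinB -EFinM.
  by rewrite (@le_anti _ _ u v) ?uv// subrr mule0 mulr0.
by apply: ge0_le_integral => //; exact: measurable_cst.
Qed.

Lemma lipschitz_within_continuous (R : realType) (n : nat)
    (g : R -> 'rV[R]_n) (L : R) :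
  (forall l m, 0 <= l -> l <= m -> m <= L -> euc_dist (g l) (g m) <= m - l) ->
  {within `[0, L], continuous g}.
Proof.
move=> gL; apply/within_continuous_euc_distP => x /=.
rewrite in_itv /= => /andP[x0 xL] e e0; exists e => // y /=.
rewrite in_itv /= => /andP[y0 yL]; apply: le_lt_trans.
have [xy|/ltW yx] := leP x y.
  by rewrite distrC ger0_norm ?subr_ge0//; exact: gL.
by rewrite euc_distC ger0_norm ?subr_ge0//; exact: gL.
Qed.

(** Cut [[0, L]] into pieces of length [v].  On a piece that starts at distance
    [d] from the boundary, [qh_reach_ball] gives a travel time at most
    [v / (d - v)], while the integral is at least [v / (d + v)].  The ratio is at
    most [kappa] for small [v], since [d] is bounded below by compactness. *)
Lemma qh_time_le_integral (R : realType) (n : nat) (Omega : set 'rV[R]_n)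
    (g : R -> 'rV[R]_n) (L : R) :
  bounded_domain Omega -> euc_boundary Omega !=set0 ->
  0 <= L -> (forall l, l \in `[0, L] -> Omega (g l)) ->
  (forall l m, 0 <= l -> l <= m -> m <= L -> euc_dist (g l) (g m) <= m - l) ->
  ((qh_time Omega (g 0) (g L))%:E <=
    \int[lebesgue_measure]_(l in `[0%R, L]) ((bdist Omega (g l))^-1)%:E)%E.
Proof.
move=> dO b0 L0 gO gL; have [oO _ _ _] := dO.
have gc := lipschitz_within_continuous gL.
have mphi := qh_density_measurable (measurable_itv _) oO b0 gc gO.
have d_gt0 l : l \in `[0, L] -> 0 < bdist Omega (g l).
  by move=> /gO; exact: bdist_gt0.
have [l0 l0I l0_min] := EVT_min L0 (bdist_comp_continuous b0 gc).
set m := bdist Omega (g l0) in l0_min; have m0 : 0 < m by exact: d_gt0.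
set phi := fun l => ((bdist Omega (g l))^-1)%:E.
have phi0 l : l \in `[0, L] -> (0 <= phi l)%E.
  by move=> lI; rewrite lee_fin invr_ge0 ltW// d_gt0.
suff main kappa : 1 < kappa -> ((qh_time Omega (g 0) (g L))%:E <=
    kappa%:E * \int[lebesgue_measure]_(l in `[0%R, L]) phi l)%E.
  have : (0 <= \int[lebesgue_measure]_(l in `[0%R, L]) phi l)%E.
    by apply: integral_ge0 => l; exact: phi0.
  move: main; case: (integral _ _ _) => [I main I0|_ _|_].
  - rewrite lee_fin in I0; rewrite lee_fin; exact: le_of_le_mul_gt1.
  - by rewrite leey.
  - by rewrite leNgt ltNye.
move=> k1; have k0 : 0 < kappa by lra.
(* N makes v so small that (m + v) / (m - v) < kappa, see vk. *)
pose N := (Num.bound (L * (kappa + 1) / (m * (kappa - 1)))).+1.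
pose v := L / N%:R.
have v0 : 0 <= v by rewrite divr_ge0.
have mk : 0 < m * (kappa - 1) by rewrite mulr_gt0// subr_gt0.
have vk : v * (kappa + 1) < m * (kappa - 1).
  rewrite /v mulrAC ltr_pdivrMr// [ltRHS]mulrC -ltr_pdivrMr//.
  have X0 : 0 <= L * (kappa + 1) / (m * (kappa - 1)).
    by rewrite divr_ge0 ?(ltW mk)// mulr_ge0//; lra.
  by apply: lt_le_trans (archi_boundP X0) _; rewrite ler_nat.
have vm : v < m by nra.
have NvL : N%:R * v = L by rewrite /v mulrC divfK// pnatr_eq0.
have kvL k : (k <= N)%N -> k%:R * v <= L.
  by move=> kN; rewrite -[leRHS]NvL ler_wpM2r// ler_nat.
have kvI k : (k <= N)%N -> k%:R * v \in `[0, L].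
  by move=> kN; rewrite in_itv /= kvL// mulr_ge0.
suff step k : (k <= N)%N -> ((qh_time Omega (g 0) (g (k%:R * v)))%:E <=
    kappa%:E * \int[lebesgue_measure]_(l in `[0%R, (k%:R * v)%R]) phi l)%E.
  by have := step N (leqnn _); rewrite NvL.
elim: k => [_|k IH kN].
  have O0 : Omega (g 0) by apply: gO; rewrite in_itv /= lexx.
  rewrite mul0r qh_timexx// mule_ge0 ?lee_fin ?(ltW k0)//.
  apply: integral_ge0 => l /=; rewrite in_itv /= => l00; apply: phi0.
  by rewrite -(le_anti l00) in_itv /= lexx.
have kN' := ltnW kN; set u := k%:R * v; set w := k.+1%:R * v.
have uwE : w - u = v by rewrite /w /u -natr1; ring.
have uw : u <= w by rewrite -subr_ge0 uwE.
have u0 : 0 <= u by rewrite mulr_ge0.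
have Ou : Omega (g u) by apply: gO; exact: kvI.
have Ow : Omega (g w) by apply: gO; exact: kvI.
rewrite (ge0_integral_itv_split mphi phi0 u0 uw (kvL _ kN)).
have sub l : l \in `]u, w] -> l \in `[0, L].
  rewrite !in_itv /= => /andP[ul lw].
  by rewrite (le_trans u0 (ltW ul)) (le_trans lw)// kvL.
rewrite ge0_muleDr; last 2 first.
- apply: integral_ge0 => l /= lI; apply: phi0; move: lI; rewrite !in_itv /=.
  by move=> /andP[-> /le_trans] /=; apply; rewrite kvL.
- by apply: integral_ge0 => l /= /sub; exact: phi0.
apply: (@le_trans _ _ ((qh_time Omega (g 0) (g u))%:E +
    (qh_time Omega (g u) (g w))%:E)%E).
  rewrite -EFinD lee_fin; apply: qh_time_triangle => //.
  by apply: gO; rewrite in_itv /= lexx.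
apply: leeD; first exact: IH.
have uI := kvI _ kN'; have du := d_gt0 _ uI; have mdu := l0_min _ uI.
rewrite -/u in du mdu; set d := bdist Omega (g u) in du mdu.
have low : (((d + v)^-1 * (w - u))%:E <=
    \int[lebesgue_measure]_(l in `]u, w]) phi l)%E.
  apply: ge0_le_integral_itv => //.
  - by apply: measurable_funS mphi => // l /= /sub.
  - by rewrite invr_ge0; lra.
  - move=> l lI; have lI' := sub _ lI; rewrite lee_fin lef_pV2 ?posrE; last 2 first.
    + by lra.
    + exact: d_gt0.
    move: lI; rewrite in_itv /= => /andP[ul lw].
    have := bdist_lipschitz (g l) (g u) b0; rewrite euc_distC.
    have := gL u l u0 (ltW ul) (le_trans lw (kvL _ kN)).
    by rewrite -/d; lra.
have k0' : (0 <= kappa%:E)%E by rewrite lee_fin ltW.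
apply: le_trans (lee_wpmul2l k0' low); rewrite -EFinM lee_fin uwE.
have r_le : euc_dist (g u) (g w) <= v by rewrite -uwE; apply: gL => //; exact: kvL.
set r := euc_dist _ _ in r_le.
have r_lt : r < d by lra.
apply: le_trans (qh_timeP (qh_reach_ball oO b0 Ou r_lt)) _.
rewrite -/r -/d; apply: (@le_trans _ _ (v / (d - v))).
  apply: ler_pM => //; first exact: euc_dist_ge0.
  - by rewrite invr_ge0; lra.
  - by rewrite lef_pV2 ?posrE; lra.
rewrite ler_pdivrMr; last by lra.
rewrite (_ : kappa * _ * _ = v * (kappa * (d - v) / (d + v))); last by ring.
rewrite ler_peMr// ler_pdivlMr; last by lra.
nra.
Qed.

(** * The quasihyperbolic distance as a minimal travel time *)

(** Each term of a polygonal length is bounded by the increment of the function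
    [bdist Omega (h s) * expR (u - s)] of [u], so that the sum telescopes. *)
Lemma qh_path_curve_length (R : realType) (n : nat) (Omega : set 'rV[R]_n)
    (h : R -> 'rV[R]_n) (T s t : R) :
  euc_boundary Omega !=set0 -> qh_path Omega h T ->
  0 <= s -> s <= t -> t <= T ->
  (curve_length h s t <= (bdist Omega (h s) * (expR (t - s) - 1))%:E)%E.
Proof.
move=> b0 [hO hh] s0 st tT; apply: curve_length_le => p.
suff main u : s <= u -> itv_partition u t p -> polygonal_length h u p <=
    bdist Omega (h s) * (expR (t - s) - expR (u - s)).
  by move=> /(main _ (lexx s)); rewrite subrr expR0 lee_fin.
elim: p u => [u _ [_ /= /eqP ->]|v p IH u su /itv_partition_consP[uv vt]].
  by rewrite polygonal_length_nil subrr mulr0.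
have sv := le_trans su (ltW uv); have v_t := itv_partition_ends_le vt.
have sI : 0 <= s <= T by rewrite s0 (le_trans st).
have uI : 0 <= u <= T by rewrite (le_trans s0)// (le_trans (le_trans (ltW uv) v_t)).
have vI : 0 <= v <= T by rewrite (le_trans s0)// (le_trans v_t).
have du : bdist Omega (h u) <= bdist Omega (h s) * expR (u - s).
  apply: bdist_le_expR => //; apply: le_trans (hh _ _ sI uI) _.
  by rewrite distrC ger0_norm ?subr_ge0.
have uv_le : euc_dist (h u) (h v) <= bdist Omega (h u) * (expR (v - u) - 1).
  by apply: le_trans (hh _ _ uI vI) _; rewrite distrC ger0_norm ?subr_ge0// ltW.
have e0 : 0 <= expR (v - u) - 1.
  by rewrite subr_ge0 -expR0 ler_expR subr_ge0 ltW.
rewrite polygonal_length_cons; apply: le_trans (lerD uv_le (IH _ sv vt)) _.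
have := ler_wpM2r e0 du.
have -> : expR (v - s) = expR (u - s) * expR (v - u).
  by rewrite -expRD; congr expR; ring.
lra.
Qed.

Lemma qh_path_continuous (R : realType) (n : nat) (Omega : set 'rV[R]_n)
    (h : R -> 'rV[R]_n) (T : R) :
  open Omega -> euc_boundary Omega !=set0 -> qh_path Omega h T ->
  {within `[0, T], continuous h}.
Proof.
move=> oO b0 [hO hh]; apply/within_continuous_euc_distP => t /=.
rewrite in_itv /= => tT e e0.
have [k k0 ke] := expR_sub1_small (bdist_gt0 oO b0 (hO t tT)) e0.
exists k => // s; rewrite /= in_itv /= => sT; rewrite /ball /= => ts.
by apply: le_lt_trans (hh _ _ tT sT) _; apply: ke; exact: ltW.
Qed.

Lemma qh_path_rectifiable (R : realType) (n : nat) (Omega : set 'rV[R]_n)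
    (h : R -> 'rV[R]_n) (T : R) :
  open Omega -> euc_boundary Omega !=set0 -> 0 <= T -> qh_path Omega h T ->
  rectifiable_curve Omega (h 0) (h T) h 0 T.
Proof.
move=> oO b0 T0 hp; split=> //.
- exact: qh_path_continuous hp.
- by move=> t; rewrite in_itv; exact: hp.1.
- by apply: le_lt_trans (qh_path_curve_length b0 hp _ T0 _) _; rewrite ?ltry.
Qed.

(** Cut [[0, T]] into pieces of duration [w].  On a piece that starts at a point
    at distance [d] from the boundary, the length is at most [d * (expR w - 1)]
    and the density at most [expR w / d]; the piece contributes at most
    [expR w * (expR w - 1)], that is at most [w * expR (2 * w)]. *)
Lemma line_integral_qh_path (R : realType) (n : nat) (Omega : set 'rV[R]_n)
    (h : R -> 'rV[R]_n) (T kappa : R) :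
  open Omega -> euc_boundary Omega !=set0 -> 0 <= T -> qh_path Omega h T ->
  1 < kappa ->
  (line_integral (fun z => (bdist Omega z)^-1)%R h 0 T <= (kappa * T)%:E)%E.
Proof.
move=> oO b0 T0 hp k1.
have [_ hc hO' _ Lfin] := qh_path_rectifiable oO b0 T0 hp.
have [hO hh] := hp.
pose len t := fine (curve_length h 0 t).
have lenE t : 0 <= t -> t <= T -> curve_length h 0 t = (len t)%:E.
  move=> t0 tT; rewrite fineK// ge0_fin_numE ?curve_length_ge0//.
  exact: le_lt_trans (curve_length_mono h 0 tT) Lfin.
have LE := lenE T T0 (lexx T).
have len0 t : 0 <= t -> t <= T -> 0 <= len t.
  by move=> t0 tT; rewrite -lee_fin -lenE// curve_length_ge0.
have len_mono s t : 0 <= s -> s <= t -> t <= T -> len s <= len t.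
  move=> s0 st tT; rewrite -lee_fin -!lenE ?curve_length_mono//.
    exact: le_trans st.
  exact: le_trans tT.
pose arc := arc_length_param h 0 T.
have arcc : {within `[0, len T], continuous arc}.
  apply: lipschitz_within_continuous => l m _ lm mL.
  by apply: arc_length_param_lipschitz => //; rewrite LE lee_fin.
have arc_itv l : l \in `[0, len T] -> arc_length_time h 0 T l \in `[0, T].
  move=> /itvP lI; apply: arc_length_time_itv => //.
  by rewrite LE lee_fin lI.
have arcO l : l \in `[0, len T] -> Omega (arc l).
  by move=> /arc_itv; exact: hO'.
set phi := fun l => ((bdist Omega (arc l))^-1)%:E.
have mphi : measurable_fun `[0, len T] phi.
  exact: qh_density_measurable (measurable_itv _) oO b0 arcc arcO.
have d_gt0 l : l \in `[0, len T] -> 0 < bdist Omega (arc l).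
  by move=> /arcO; exact: bdist_gt0.
have phi0 l : l \in `[0, len T] -> (0 <= phi l)%E.
  by move=> lI; rewrite lee_fin invr_ge0 ltW// d_gt0.
rewrite /line_integral -/(len T) -/phi.
have [T_eq0|T_neq0] := eqVneq T 0.
  have -> : len T = 0.
    apply/eqP; rewrite eq_le len0// andbT -lee_fin -LE T_eq0.
    have h00 : 0 <= (0 : R) by [].
    apply: le_trans (qh_path_curve_length b0 hp h00 h00 T0) _.
    by rewrite subrr expR0 subrr mulr0.
  by rewrite set_itv1 integral_set1 T_eq0 mulr0.
have T_gt0 : 0 < T by rewrite lt_neqAle eq_sym T_neq0.
have lnk : 0 < ln kappa by rewrite ln_gt0.
(* N makes w so small that expR (2 * w) <= kappa, see wk. *)
pose N := (Num.bound (2 * T / ln kappa)).+1.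
pose w := T / N%:R.
have w0 : 0 < w by rewrite divr_gt0.
have wk : 2 * w <= ln kappa.
  rewrite /w mulrA ler_pdivrMr// [leRHS]mulrC -ler_pdivrMr//.
  have X0 : 0 <= 2 * T / ln kappa by rewrite divr_ge0 ?(ltW lnk)// mulr_ge0.
  by apply: ltW; apply: lt_le_trans (archi_boundP X0) _; rewrite ler_nat.
have NwT : N%:R * w = T by rewrite /w mulrC divfK// pnatr_eq0.
have kwT k : (k <= N)%N -> k%:R * w <= T.
  by move=> kN; rewrite -[leRHS]NwT ler_wpM2r ?(ltW w0)// ler_nat.
have kw0 k : 0 <= k%:R * w by rewrite mulr_ge0// ltW.
suff step k : (k <= N)%N ->
    (\int[lebesgue_measure]_(l in `[0%R, len (k%:R * w)%R]) phi l <=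
      (k%:R * (expR w * (expR w - 1)))%:E)%E.
  have := step N (leqnn _); rewrite NwT => /le_trans; apply; rewrite lee_fin.
  have ew : expR w - 1 <= w * expR w.
    rewrite lerBlDr -lerBlDl -{1}[expR w]mul1r -mulrBl.
    have := expR_ge1Dx (- w).
    by rewrite -(ler_pM2r (expR_gt0 w)) -expRD addNr expR0.
  apply: (@le_trans _ _ (N%:R * (expR w * (w * expR w)))).
    by rewrite ler_wpM2l// ler_wpM2l// ltW// expR_gt0.
  have -> : N%:R * (expR w * (w * expR w)) = expR (2 * w) * T.
    by rewrite (_ : 2 * w = w + w) ?expRD -?NwT; ring.
  rewrite ler_wpM2r// -[leRHS]lnK ?posrE; last by lra.
  by rewrite ler_expR.
elim: k => [_|k IH kN].
  have -> : len (0%:R * w) = 0.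
    rewrite mul0r; apply/eqP; rewrite eq_le len0// andbT -lee_fin -lenE//.
    have h00 : 0 <= (0 : R) by [].
    apply: le_trans (qh_path_curve_length b0 hp h00 h00 T0) _.
    by rewrite subrr expR0 subrr mulr0.
  by rewrite set_itv1 integral_set1 mul0r.
set s := k%:R * w; set t := k.+1%:R * w.
have tsE : t - s = w by rewrite /t /s -natr1; ring.
have st : s <= t by rewrite -subr_ge0 tsE ltW.
have s0 : 0 <= s := kw0 k; have tT : t <= T := kwT _ kN.
have sT : s <= T := le_trans st tT; have t0 : 0 <= t := kw0 k.+1.
have lst := len_mono _ _ s0 st tT; have ltT := len_mono _ _ t0 tT (lexx T).
rewrite (ge0_integral_itv_split mphi phi0 (len0 _ s0 sT) lst ltT).
rewrite -natr1 mulrDl mul1r EFinD; apply: leeD; first exact: IH (ltnW kN).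
have sub l : l \in `]len s, len t] -> l \in `[0, len T].
  rewrite !in_itv /= => /andP[sl lt].
  by rewrite (le_trans (len0 _ s0 sT) (ltW sl)) (le_trans lt).
have ds : 0 < bdist Omega (h s).
  by apply: bdist_gt0 => //; apply: hO; rewrite s0.
set M := expR w / bdist Omega (h s).
apply: (@le_trans _ _ (M * (len t - len s))%:E).
  apply: ge0_integral_itv_le => //.
  - by apply: measurable_funS mphi => // l /= /sub.
  - by move=> l /sub; exact: phi0.
  - move=> l lI; have lI' := sub _ lI; rewrite lee_fin /M.
    rewrite -[X in X^-1]mulr1 -[leLHS]mul1r ler_pdivrMr ?mulr1 ?d_gt0//.
    rewrite mulrAC ler_pdivlMr// mul1r mulrC.
    move: lI; rewrite in_itv /= => /andP[sl lt].
    have := arc_itv _ lI'; rewrite in_itv /= => /andP[a0 aT].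
    have lL : (l%:E <= curve_length h 0 T)%E.
      by rewrite LE lee_fin (le_trans lt).
    have sa : s <= arc_length_time h 0 T l.
      by apply: arc_length_time_ge => //; rewrite lenE// lte_fin.
    have at_ : arc_length_time h 0 T l <= t.
      by apply: arc_length_time_le; rewrite ?in_itv /= ?t0// lenE// lee_fin.
    apply: le_trans (bdist_le_expR b0 (hh (arc_length_time h 0 T l) s _ _)) _.
    + by rewrite a0.
    + by rewrite s0.
    rewrite ler_wpM2l ?(ltW (d_gt0 _ _))// ler_expR ger0_norm ?subr_ge0//.
    by rewrite -tsE lerB.
have lts : len t - len s <= bdist Omega (h s) * (expR w - 1).
  rewrite lerBlDl -lee_fin EFinD -!lenE// -tsE.
  apply: le_trans (curve_length_triangle h s0 st) _.
  by rewrite leeD2l// (qh_path_curve_length b0 hp).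
have M0 : 0 <= M by rewrite divr_ge0 ?(ltW ds)// ltW// expR_gt0.
rewrite lee_fin; apply: le_trans (ler_wpM2l M0 lts) _.
by rewrite /M mulrA divfK// gt_eqF.
Qed.

Lemma qh_distE (R : realType) (n : nat) (Omega : set 'rV[R]_n) x y :
  bounded_domain Omega -> euc_boundary Omega !=set0 -> Omega x -> Omega y ->
  qh_dist Omega x y = qh_time Omega x y.
Proof.
move=> dO b0 Ox Oy; have [oO _ _ _] := dO.
rewrite /qh_dist; set S := [set v | _].
suff -> : ereal_inf S = (qh_time Omega x y)%:E by [].
apply/eqP; rewrite eq_le; apply/andP; split.
  have [T0 [h [hp hx hy]]] := qh_reach_attained dO b0 Ox Oy.
  set T := qh_time Omega x y in T0 hp hy *.
  set I := line_integral (fun z => (bdist Omega z)^-1)%R h 0 T.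
  have SI : S I.
    exists h, 0, T; split=> //; rewrite -{1}hx -hy.
    exact: qh_path_rectifiable.
  apply: ge_ereal_inf; exists I => //.
  have I0 : (0 <= I)%E.
    apply: integral_ge0 => l _; rewrite lee_fin invr_ge0.
    by apply: le_bdist => // z _; exact: euc_dist_ge0.
  have main kappa : 1 < kappa -> (I <= (kappa * T)%:E)%E.
    exact: line_integral_qh_path.
  move: main I0; case: (I) => [r|/(_ 2)|//]; last first.
    by move=> /(_ (ltr1n _ 2)); rewrite leNgt ltry.
  by move=> main _; rewrite lee_fin; apply: le_of_le_mul_gt1.
apply: le_ereal_inf_tmp => _ [g [a [b [[ab gc gO [gx gy] gfin] ->]]]].
have LE : curve_length g a b = (fine (curve_length g a b))%:E.
  by rewrite fineK// ge0_fin_numE// curve_length_ge0.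
set L := fine _ in LE.
have L0 : 0 <= L by rewrite -lee_fin -LE curve_length_ge0.
have := @qh_time_le_integral _ _ Omega (arc_length_param g a b) L dO b0 L0.
rewrite arc_length_param0// arc_length_param_end// gx gy; apply.
  move=> l; rewrite in_itv /= => /andP[_ lL]; apply: gO.
  by apply: arc_length_time_itv => //; rewrite LE lee_fin.
move=> l m _ lm mL; apply: arc_length_param_lipschitz => //.
by rewrite LE lee_fin.
Qed.

(** * Quasihyperbolic metric geometry *)

Lemma qh_dist_ge0 (R : realType) (n : nat) (Omega : set 'rV[R]_n) x y :
  bounded_domain Omega -> euc_boundary Omega !=set0 -> Omega x -> Omega y ->
  0 <= qh_dist Omega x y.
Proof. by move=> dO b0 Ox Oy; rewrite qh_distE// qh_time_ge0. Qed.

Lemma qh_distC (R : realType) (n : nat) (Omega : set 'rV[R]_n) x y :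
  bounded_domain Omega -> euc_boundary Omega !=set0 -> Omega x -> Omega y ->
  qh_dist Omega x y = qh_dist Omega y x.
Proof. by move=> dO b0 Ox Oy; rewrite !qh_distE// qh_timeC. Qed.

Lemma qh_dist_triangle (R : realType) (n : nat) (Omega : set 'rV[R]_n) y x z :
  bounded_domain Omega -> euc_boundary Omega !=set0 ->
  Omega x -> Omega y -> Omega z ->
  qh_dist Omega x z <= qh_dist Omega x y + qh_dist Omega y z.
Proof. by move=> dO b0 Ox Oy Oz; rewrite !qh_distE// qh_time_triangle. Qed.

(** Makes [qh_dist] control the Euclidean distance. *)
Lemma euc_dist_le_qh_dist (R : realType) (n : nat) (Omega : set 'rV[R]_n) x y :
  bounded_domain Omega -> euc_boundary Omega !=set0 -> Omega x -> Omega y ->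
  euc_dist x y <= bdist Omega x * (expR (qh_dist Omega x y) - 1).
Proof.
move=> dO b0 Ox Oy; rewrite qh_distE//.
have [T0 [h [[hO hh] hx hy]]] := qh_reach_attained dO b0 Ox Oy.
have := hh 0 (qh_time Omega x y).
by rewrite hx hy !lexx T0 sub0r normrN ger0_norm//; exact.
Qed.

(** Makes the Euclidean distance control [qh_dist] locally. *)
Lemma qh_dist_near (R : realType) (n : nat) (Omega : set 'rV[R]_n) x (e : R) :
  bounded_domain Omega -> euc_boundary Omega !=set0 -> Omega x -> 0 < e ->
  exists2 d : R, 0 < d & forall y, euc_dist x y < d ->
    Omega y /\ qh_dist Omega x y < e.
Proof.
move=> dO b0 Ox e0; have [oO _ _ _] := dO; have dx := bdist_gt0 oO b0 Ox.
have e1 : 0 < 1 + e by rewrite addr_gt0.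
exists (bdist Omega x * e / (1 + e)); first by rewrite divr_gt0// mulr_gt0.
move=> y; rewrite ltr_pdivlMr// => xy; have r0 := euc_dist_ge0 x y.
have r_lt : euc_dist x y < bdist Omega x by nra.
have Oy := bdist_ball oO Ox r_lt; split=> //; rewrite qh_distE//.
apply: le_lt_trans (qh_timeP (qh_reach_ball oO b0 Ox r_lt)) _.
by rewrite ltr_pdivrMr ?subr_gt0//; nra.
Qed.

(** An optimal path is a geodesic: the time between two of its points is at most
    the parameter difference, and a strict inequality anywhere would shorten the
    total time. *)
Lemma qh_geodesic_exists (R : realType) (n : nat) (Omega : set 'rV[R]_n) x y :
  bounded_domain Omega -> euc_boundary Omega !=set0 -> Omega x -> Omega y ->
  exists g, [/\ qh_geodesic Omega g 0 (qh_dist Omega x y), g 0 = x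
    & g (qh_dist Omega x y) = y].
Proof.
move=> dO b0 Ox Oy; rewrite qh_distE//.
have [T0 [h [hp hx hy]]] := qh_reach_attained dO b0 Ox Oy.
set T := qh_time Omega x y in T0 hp hy *.
exists h; split=> //; split=> // [t|]; first by rewrite in_itv; exact: hp.1.
have iso s t : 0 <= s -> s <= t -> t <= T -> qh_time Omega (h s) (h t) = t - s.
  move=> s0 st tT; apply/eqP; rewrite eq_le.
  rewrite (qh_timeP (qh_path_sub hp s0 st tT)) /=.
  have Os : Omega (h s) by apply: hp.1; rewrite s0 (le_trans st).
  have Ot : Omega (h t) by apply: hp.1; rewrite (le_trans s0)//.
  have h1 := qh_time_triangle dO b0 Ox Os Oy.
  have h2 := qh_time_triangle dO b0 Os Ot Oy.
  have := qh_timeP (qh_path_sub hp (lexx 0) s0 (le_trans st tT)).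
  have := qh_timeP (qh_path_sub hp (le_trans s0 st) tT (lexx T)).
  by rewrite hx hy; move: h1 h2; rewrite -/T; lra.
move=> s t; rewrite !in_itv /= => /andP[s0 sT] /andP[t0 tT].
rewrite qh_distE//; [|by apply: hp.1; rewrite s0|by apply: hp.1; rewrite t0].
have [st|/ltW ts] := leP s t.
  by rewrite iso// distrC ger0_norm ?subr_ge0.
by rewrite qh_timeC iso// ger0_norm ?subr_ge0.
Qed.

Lemma qh_dist_bounded_compact (R : realType) (n : nat) (Omega K : set 'rV[R]_n)
    o :
  bounded_domain Omega -> euc_boundary Omega !=set0 -> Omega o ->
  compact K -> K `<=` Omega ->
  exists C : R, forall z, K z -> qh_dist Omega o z <= C.
Proof.
move=> dO b0 Oo cK KO; apply: contrapT => unb.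
have far (N : nat) : exists z, K z /\ N%:R < qh_dist Omega o z.
  apply: contrapT => nz; apply: unb; exists N%:R => z Kz.
  by rewrite leNgt; apply/negP => zN; apply: nz; exists z.
have [z zP] := choice far.
have [U [UU oU]] := ultraFilterLemma eventually_filter.
have UP : ProperFilter U by exact: ultra_proper.
have [|l Kl zl] := ultra_fmap_compact (u := z) UU cK.
  by move=> N; exact: (zP N).1.
have [d d0 dl] := qh_dist_near dO b0 (KO _ Kl) ltr01.
pose B := Num.bound (qh_dist Omega o l + 1).
have /filter_ex[N [lN BN]] : \forall N \near U,
    euc_dist l (z N) < d /\ (B <= N)%N.
  apply: filterI; last by apply: oU; exists B.
  by have /cvg_euc_dist0P := zl; exact.
have [OzN klz] := dl _ lN.
have := qh_dist_triangle dO b0 Oo (KO _ Kl) OzN.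
have := (zP N).2; have : B%:R <= N%:R :> R by rewrite ler_nat.
have : qh_dist Omega o l + 1 < B%:R.
  by apply: archi_boundP; rewrite addr_ge0// qh_dist_ge0//; exact: KO.
lra.
Qed.

Lemma cvg_boundary_qh_dist (R : realType) (n : nat) (Omega : set 'rV[R]_n)
    (T : Type) (F : set_system T) {FF : Filter F} (u : T -> 'rV[R]_n) o p :
  bounded_domain Omega -> euc_boundary Omega p -> Omega o ->
  (forall t, Omega (u t)) -> u @ F --> p ->
  forall A : R, \forall t \near F, A < qh_dist Omega o (u t).
Proof.
move=> dO bp Oo Ou up A; have [oO _ _ _] := dO.
have b0 : euc_boundary Omega !=set0 by exists p.
have : bdist Omega (u t) @[t --> F] --> (0 : R).
  by rewrite -(bdist_boundary bp); exact: cvg_bdist.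
have c0 : 0 < bdist Omega o * expR (- A).
  by rewrite mulr_gt0 ?expR_gt0 ?bdist_gt0.
move=> /cvgrPdist_lt/(_ _ c0) du; near=> t.
have dt0 := bdist_gt0 oO b0 (Ou t).
have : bdist Omega (u t) < bdist Omega o * expR (- A).
  rewrite -[ltLHS]gtr0_norm// -normrN -sub0r.
  by near: t.
rewrite expRN ltr_pdivlMr ?expR_gt0// => dA.
have := bdist_le_expR b0 (euc_dist_le_qh_dist dO b0 (Ou t) Oo).
rewrite (qh_distC dO b0 Oo (Ou t)) -ltr_expR => /(lt_le_trans dA).
by rewrite ltr_pM2l.
Unshelve. all: by end_near. Qed.

(** A limit inside of [Omega] would be at finite distance from [o]. *)
Lemma qh_dist_infty_boundary (R : realType) (n : nat) (Omega : set 'rV[R]_n)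
    (T : Type) (F : set_system T) {FF : ProperFilter F} (u : T -> 'rV[R]_n) o p :
  bounded_domain Omega -> euc_boundary Omega !=set0 -> Omega o ->
  (forall t, Omega (u t)) -> closure Omega p -> u @ F --> p ->
  (forall A : R, \forall t \near F, A < qh_dist Omega o (u t)) ->
  euc_boundary Omega p.
Proof.
move=> dO b0 Oo Ou cp up uoo; have [oO _ _ _] := dO.
split=> //; rewrite (interior_id _).1// => Op.
have [d d0 dp] := qh_dist_near dO b0 Op ltr01.
have /filter_ex[t [ptd tA]] : \forall t \near F, euc_dist p (u t) < d /\
    qh_dist Omega o p + 1 < qh_dist Omega o (u t).
  by apply: filterI (uoo _); have /cvg_euc_dist0P := up; exact.
have [_ k1] := dp _ ptd.
by have := qh_dist_triangle dO b0 Oo Op (Ou t); lra.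
Qed.

(** A geodesic from [u] to [v] passes through a fixed compact set [K], on which
    the distance to [o] is at most [C]; passing by [o] instead costs at most
    [2 * C] more.  In other words, the Gromov product of [u] and [v] at [o] is
    bounded. *)
Lemma qh_visibility_product (R : realType) (n : nat) (Omega : set 'rV[R]_n)
    o p q :
  bounded_domain Omega -> qh_visibility Omega -> Omega o ->
  euc_boundary Omega p -> euc_boundary Omega q -> p <> q ->
  exists C : R, exists U V : set 'rV[R]_n, [/\ nbhs p U, nbhs q V &
    forall u v, Omega u -> Omega v -> U u -> V v ->
      qh_dist Omega o u + qh_dist Omega o v <= qh_dist Omega u v + C].
Proof.
move=> dO vis Oo bp bq pq; have b0 : euc_boundary Omega !=set0 by exists p.
have [U [V [K [pU qV _ [cK KO] UVK]]]] := vis _ _ bp bq pq.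
have [C CK] := qh_dist_bounded_compact dO b0 Oo cK KO.
exists (C + C), U, V; split=> // u v Ou Ov Uu Vv.
have [g [gg gu gv]] := qh_geodesic_exists dO b0 Ou Ov.
have T0 := qh_dist_ge0 dO b0 Ou Ov.
have := UVK g _ gg; rewrite gu gv => /(_ Uu Vv)[_ [[t tT <-] Kz]].
have Oz := KO _ Kz; have kz := CK _ Kz.
have [_ _ iso] := gg.
have := tT; rewrite /= in_itv /= => /andP[t0 t_T].
have I0 : 0 \in `[0, qh_dist Omega u v] by rewrite in_itv /= lexx.
have IT : qh_dist Omega u v \in `[0, qh_dist Omega u v] by rewrite in_itv /= lexx T0.
have := iso _ _ tT I0; have := iso _ _ tT IT.
rewrite gu gv subr0 distrC !ger0_norm ?subr_ge0//.
have := qh_dist_triangle dO b0 Oo Oz Ou; have := qh_dist_triangle dO b0 Oo Oz Ov.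
lra.
Qed.

Lemma qh_continuous_geodesic (R : realType) (n : nat)
    (Omega Omega' : set 'rV[R]_n) (f : 'rV[R]_n -> 'rV[R]_n) g (a b : R) :
  bounded_domain Omega' -> euc_boundary Omega' !=set0 ->
  (forall x, Omega x -> Omega' (f x)) -> qh_continuous Omega Omega' f ->
  qh_geodesic Omega g a b -> {within `[a, b], continuous (f \o g)}.
Proof.
move=> dO' b0' fO fc [_ gO iso]; have [oO' _ _ _] := dO'.
apply/within_continuous_euc_distP => t tab e e0.
have Ot := gO t tab.
have [k k0 ke] := expR_sub1_small (bdist_gt0 oO' b0' (fO _ Ot)) e0.
have [d d0 dk] := fc _ Ot k k0.
exists d => // s sab ts; have Os := gO s sab.
apply: le_lt_trans (euc_dist_le_qh_dist dO' b0' (fO _ Ot) (fO _ Os)) _.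
apply: ke; apply: ltW; apply: dk => //.
by rewrite iso.
Qed.

Lemma euc_dist_crossing (R : realType) (n : nat) (g : R -> 'rV[R]_n)
    (a b r : R) (x : 'rV[R]_n) :
  a <= b -> {within `[a, b], continuous g} ->
  euc_dist x (g a) <= r -> r <= euc_dist x (g b) ->
  exists2 t, t \in `[a, b] & euc_dist x (g t) = r.
Proof.
move=> ab /subspace_continuousP gc ga gb.
apply: (@IVT R (fun t => euc_dist x (g t))) => //; last first.
  by rewrite ge_min le_max ga gb orbT.
apply/subspace_continuousP => t tab.
by apply: cvg_euc_dist; [exact: cvg_cst|exact: gc].
Qed.

(** * Boundary extension *)

(** The core of the argument: two limits [xi] and [eta] of [f] at [p] coincide,
    because otherwise a third boundary point [zeta] would be seen from both at
    bounded Gromov product, whereas [zeta] is the limit of almost intermediate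
    points that escape to infinity. *)
Lemma qh_embedding_cauchy (R : realType) (n : nat)
    (Omega Omega' : set 'rV[R]_n) (mu : R) (f : 'rV[R]_n -> 'rV[R]_n) p :
  bounded_domain Omega -> qh_well_behaved Omega ->
  bounded_domain Omega' -> euc_boundary Omega' !=set0 ->
  qh_visibility Omega' ->
  qh_quasi_isometric_embedding mu Omega Omega' f ->
  qh_continuous Omega Omega' f ->
  euc_boundary Omega p ->
  forall e : R, 0 < e -> exists2 d : R, 0 < d & forall x y, Omega x -> Omega y ->
    euc_dist p x < d -> euc_dist p y < d -> euc_dist (f x) (f y) < e.
Proof.
move=> dO wb dO' b0' vis [fO fqi] fc bp e e0; apply: contrapT => nd.
have b0 : euc_boundary Omega !=set0 by exists p.
have far (N : nat) : exists xy : 'rV[R]_n * 'rV[R]_n,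
    [/\ Omega xy.1, Omega xy.2, euc_dist p xy.1 < N.+1%:R^-1,
        euc_dist p xy.2 < N.+1%:R^-1 & e <= euc_dist (f xy.1) (f xy.2)].
  apply: contrapT => nxy; apply: nd; exists N.+1%:R^-1; first by rewrite invr_gt0.
  move=> x y Ox Oy px py; rewrite ltNge; apply/negP => fxy.
  by apply: nxy; exists (x, y).
have {far}[xy xyP] := choice far.
pose x N := (xy N).1; pose y N := (xy N).2.
have Ox N : Omega (x N) by have [] := xyP N.
have Oy N : Omega (y N) by have [] := xyP N.
have to_p (u : nat -> 'rV[R]_n) :
    (forall N, euc_dist p (u N) < N.+1%:R^-1) -> u @ \oo --> p.
  move=> up; apply/cvg_euc_dist0P => d d0.
  near=> N; apply: lt_trans (up N) _; near: N.
  exact: (near_infty_natSinv_lt (PosNum d0)).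
have xp : x @ \oo --> p by apply: to_p => N; have [] := xyP N.
have yp : y @ \oo --> p by apply: to_p => N; have [] := xyP N.
pose b N := qh_dist Omega (x N) (y N).
have bge0 N : 0 <= b N by exact: qh_dist_ge0.
have [g gP] := choice (fun N => qh_geodesic_exists dO b0 (Ox N) (Oy N)).
have [x0 Ox0 goo] : exists2 x0, Omega x0 &
    qh_dist_curve Omega x0 (g k) 0 (b k) @[k --> \oo] --> +oo.
  by apply: (wb x y p g (fun=> 0) b) => // k; have [] := gP k.
have [U [UU oU]] := ultraFilterLemma eventually_filter.
have UP : ProperFilter U by exact: ultra_proper.
have cK := closure_bounded_compact dO'.
have fx_cl N : closure Omega' (f (x N)) by apply: subset_closure; exact: fO.
have fy_cl N : closure Omega' (f (y N)) by apply: subset_closure; exact: fO.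
have [xi cxi fxi] := ultra_fmap_compact (u := f \o x) UU cK fx_cl.
have [eta ceta feta] := ultra_fmap_compact (u := f \o y) UU cK fy_cl.
have Ofx0 := fO _ Ox0.
have escape (u : nat -> 'rV[R]_n) l : (forall N, Omega (u N)) ->
    (forall A : R, \forall N \near U, A < qh_dist Omega x0 (u N)) ->
    closure Omega' l -> (f \o u) @ U --> l ->
    (forall A : R, \forall N \near U, A < qh_dist Omega' (f x0) (f (u N))) /\
    euc_boundary Omega' l.
  move=> Ou uoo cl ful.
  have fuoo A : \forall N \near U, A < qh_dist Omega' (f x0) (f (u N)).
    near=> N; have /andP[+ _] := fqi _ _ Ox0 (Ou N); apply: lt_le_trans.
    by rewrite ltrBrDr; near: N; exact: uoo.
  split=> //; apply: qh_dist_infty_boundary cl ful fuoo => // N.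
  by apply: fO; exact: Ou.
have along_U (u : nat -> 'rV[R]_n) : (forall N, Omega (u N)) ->
    u @ \oo --> p ->
    forall A : R, \forall N \near U, A < qh_dist Omega x0 (u N).
  by move=> Ou up A; apply: oU; exact: cvg_boundary_qh_dist bp Ox0 Ou up A.
have [_ bxi] := escape x xi Ox (along_U x Ox xp) cxi fxi.
have [_ b_eta] := escape y eta Oy (along_U y Oy yp) ceta feta.
have e_le : e <= euc_dist xi eta.
  apply: (ler_cvg_to (cvg_cst e) (cvg_euc_dist fxi feta)).
  by near=> N; have [] := xyP N.
pose r := euc_dist xi eta / 2.
have r0 : 0 < r by rewrite divr_gt0// (lt_le_trans e0).
(* Points of the image curves at distance r from xi stay away from both xi and
   eta in the limit; they exist because the image curves are continuous. *)
have cross N : exists t, 0 <= t <= b N /\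
    (euc_dist xi (f (x N)) < r -> r < euc_dist xi (f (y N)) ->
     euc_dist xi (f (g N t)) = r).
  have [gg gx gy] := gP N.
  have [fx_lt|fx_ge] := ltP (euc_dist xi (f (x N))) r; last first.
    by exists 0; rewrite lexx bge0; split.
  have [fy_gt|fy_le] := ltP r (euc_dist xi (f (y N))); last first.
    by exists 0; rewrite lexx bge0; split.
  have fgc := qh_continuous_geodesic dO' b0' fO fc gg.
  have [t tb tr] : exists2 t, t \in `[0, b N] & euc_dist xi (f (g N t)) = r.
    by apply: (euc_dist_crossing (g := f \o g N)) => //=;
      rewrite ?gx ?gy ltW.
  by exists t; split.
have [t tP] := choice cross.
pose z N := g N (t N).
have tI N : t N \in `[0, b N] by rewrite in_itv; have [] := tP N.
have Oz N : Omega (z N) by have [[_ gO _] _ _] := gP N; exact: gO.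
have zoo A : \forall N \near U, A < qh_dist Omega x0 (z N).
  apply: oU; have /cvgryPgt/(_ A) := goo; apply: filterS => N.
  move=> /lt_le_trans; apply; apply: ge_inf; last by exists (t N); first exact: tI.
  exists 0 => _ [s sI <-]; have [[_ gO _] _ _] := gP N.
  by apply: qh_dist_ge0 => //; exact: gO.
have fz_cl N : closure Omega' (f (z N)) by apply: subset_closure; exact: fO.
have [zeta czeta fzeta] := ultra_fmap_compact (u := f \o z) UU cK fz_cl.
have [fzoo bzeta] := escape z zeta Oz zoo czeta fzeta.
have fx_lt : \forall N \near U, euc_dist xi (f (x N)) < r.
  by have /cvg_euc_dist0P/(_ _ r0) := fxi.
have fy_gt : \forall N \near U, r < euc_dist xi (f (y N)).
  have /cvg_euc_dist0P/(_ _ r0) := feta; apply: filterS => N /= fy.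
  have := euc_dist_triangle (f (y N)) xi eta.
  by rewrite (euc_distC (f (y N))); move: fy; rewrite /r; lra.
have zeta_r : euc_dist xi zeta = r.
  have lim : euc_dist xi (f (z N)) @[N --> U] --> euc_dist xi zeta.
    exact: cvg_euc_dist (cvg_cst xi) fzeta.
  have limr : euc_dist xi (f (z N)) @[N --> U] --> r.
    apply: (cvg_trans (near_eq_cvg (f := fun=> r) _) (cvg_cst r)).
    by near=> N; symmetry; apply: (tP N).2; near: N.
  exact: norm_cvg_unique lim limr.
have xi_zeta : xi <> zeta.
  by move=> E; move: zeta_r r0; rewrite -E euc_distxx => ->; rewrite ltxx.
have eta_zeta : eta <> zeta.
  by move=> E; move: zeta_r r0; rewrite -E /r; lra.
have [C1 [U1 [V1 [xiU1 zetaV1 prod1]]]] :=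
  qh_visibility_product dO' vis Ofx0 bxi bzeta xi_zeta.
have [C2 [U2 [V2 [etaU2 zetaV2 prod2]]]] :=
  qh_visibility_product dO' vis Ofx0 b_eta bzeta eta_zeta.
have [N [[[u1 v1] [u2 v2]] kz]] : exists N,
    ((U1 (f (x N)) /\ V1 (f (z N))) /\ (U2 (f (y N)) /\ V2 (f (z N)))) /\
    (C1 + C2 + 3 * mu) / 2 < qh_dist Omega' (f x0) (f (z N)).
  apply: (@filter_ex _ U); near=> N; split; last by near: N; exact: fzoo.
  split; split; near: N.
  - exact: fxi xiU1.
  - exact: fzeta zetaV1.
  - exact: feta etaU2.
  - exact: fzeta zetaV2.
(* Along the geodesic, the distances from z N to x N and y N add up to b N;
   transported by f, this contradicts the sum of prod1 and prod2. *)
have := prod1 _ _ (fO _ (Ox N)) (fO _ (Oz N)) u1 v1.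
have := prod2 _ _ (fO _ (Oy N)) (fO _ (Oz N)) u2 v2.
have /andP[_] := fqi _ _ (Ox N) (Oz N).
have /andP[_] := fqi _ _ (Oy N) (Oz N).
have /andP[+ _] := fqi _ _ (Ox N) (Oy N).
have := qh_dist_triangle dO' b0' (fO _ (Ox N)) Ofx0 (fO _ (Oy N)).
rewrite (qh_distC dO' b0' (fO _ (Ox N)) Ofx0) -/(b N).
have [[_ _ iso] gx gy] := gP N.
have I0 : 0 \in `[0, b N] by rewrite in_itv /= lexx bge0.
have IT : b N \in `[0, b N] by rewrite in_itv /= lexx bge0.
have := iso _ _ I0 (tI N); have := iso _ _ IT (tI N).
rewrite gx gy -/(z N).
have [/andP[t0 tb] _] := tP N.
rewrite sub0r normrN !ger0_norm ?subr_ge0// => -> ->.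
by move: kz; lra.
Unshelve. all: by end_near. Qed.

Lemma continuous_extension (R : realType) (n : nat) (A B : set 'rV[R]_n)
    (f : 'rV[R]_n -> 'rV[R]_n) :
  (forall x, A x -> B (f x)) -> compact (closure B) ->
  (forall x, A x -> forall e : R, 0 < e -> exists2 d : R, 0 < d &
    forall y, A y -> euc_dist x y < d -> euc_dist (f x) (f y) < e) ->
  (forall p, closure A p -> ~ A p ->
    forall e : R, 0 < e -> exists2 d : R, 0 < d & forall x y, A x -> A y ->
    euc_dist p x < d -> euc_dist p y < d -> euc_dist (f x) (f y) < e) ->
  exists F : 'rV[R]_n -> 'rV[R]_n,
    [/\ {within closure A, continuous F},
        (forall x, closure A x -> closure B (F x)) &
        forall x, A x -> F x = f x].
Proof.
move=> fAB cB fc fC.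
have lim p : exists l, closure A p -> [/\ closure B l, A p -> l = f p &
    forall e : R, 0 < e -> exists2 d : R, 0 < d &
      forall y, A y -> euc_dist p y < d -> euc_dist l (f y) < e].
  have [Ap|nAp] := pselect (A p).
    exists (f p) => _; split=> //; last exact: fc.
    by apply: subset_closure; exact: fAB.
  have [cAp|] := pselect (closure A p); last by exists p.
  have near_p (N : nat) : exists y, A y /\ euc_dist p y < N.+1%:R^-1.
    have /closure_euc_distP/(_ N.+1%:R^-1) := cAp; rewrite invr_gt0.
    by move=> /(_ (ltr0Sn _ _))[y Ay py]; exists y.
  have [u uP] := choice near_p.
  have [U [UU oU]] := ultraFilterLemma eventually_filter.
  have UP : ProperFilter U by exact: ultra_proper.
  have [|l Bl ul] := ultra_fmap_compact (u := f \o u) UU cB.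
    by move=> N; apply: subset_closure; apply: fAB; exact: (uP N).1.
  exists l => _; split=> // e e0; have e2 : 0 < e / 2 by rewrite divr_gt0.
  have [d d0 dp] := fC p cAp nAp _ e2; exists d => // y Ay py.
  have [N [lN pN]] : exists N, euc_dist l (f (u N)) < e / 2 /\
      euc_dist p (u N) < d.
    apply: (@filter_ex _ U); near=> N; split; near: N.
      by have /cvg_euc_dist0P := ul; exact.
    apply: oU; near=> N; apply: lt_trans (uP N).2 _; near: N.
    exact: (near_infty_natSinv_lt (PosNum d0)).
  apply: le_lt_trans (euc_dist_triangle (f (u N)) _ _) _.
  by have := dp _ _ (uP N).1 Ay pN py; lra.
have [F FP] := choice lim; exists F; split; last first.
- by move=> x Ax; have [_ ->] := FP x (subset_closure Ax).
- by move=> x /FP[].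
apply/subspace_continuousP => p cAp; apply/cvg_euc_dist0P => e e0.
have e2 : 0 < e / 2 by rewrite divr_gt0.
have [_ _ /(_ _ e2)[d d0 dp]] := FP p cAp.
apply/nbhs_euc_distP; exists d => // q pq cAq.
have [_ _ /(_ _ e2)[c c0 cq]] := FP q cAq.
have [|y Ay qy] := (closure_euc_distP A q).1 cAq (Num.min c (d - euc_dist p q)).
  by rewrite lt_min c0 subr_gt0.
move: qy; rewrite lt_min => /andP[qc qd].
apply: le_lt_trans (euc_dist_triangle (f y) _ _) _.
have := cq _ Ay qc; rewrite euc_distC.
have /dp : euc_dist p y < d.
  by apply: le_lt_trans (euc_dist_triangle q _ _) _; rewrite -ltrBrDl.
by move=> /(_ Ay); lra.
Unshelve. all: by end_near. Qed.

Theorem theorem2p10 (R : realType) (n : nat) (n_gt0 : (0 < n)%N)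
    (Omega Omega' : set 'rV[R]_n)
    (domO : bounded_domain Omega) (wbO : qh_well_behaved Omega)
    (domO' : bounded_domain Omega') (visO' : qh_visibility Omega')
    (mu : R) (mu_ge0 : 0 <= mu)
    (f : 'rV[R]_n -> 'rV[R]_n)
    (f_qi : qh_quasi_isometric_embedding mu Omega Omega' f)
    (f_cont : qh_continuous Omega Omega' f) :
  exists F : 'rV[R]_n -> 'rV[R]_n,
    [/\ {within closure Omega, continuous F},
        (forall x, closure Omega x -> closure Omega' (F x)) &
        forall x, Omega x -> F x = f x].
Proof.
have [oO _ _ _] := domO; have [oO' _ _ _] := domO'; have [fO _] := f_qi.
have b0 := bounded_domain_boundary_neq0 n_gt0 domO.
have b0' := bounded_domain_boundary_neq0 n_gt0 domO'.
apply: (continuous_extension fO); first exact: closure_bounded_compact.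
- move=> x Ox e e0.
  have [k k0 ke] := expR_sub1_small (bdist_gt0 oO' b0' (fO _ Ox)) e0.
  have [c c0 ck] := f_cont x Ox k k0.
  have [d d0 dc] := qh_dist_near domO b0 Ox c0.
  exists d => // y Oy /dc[_ xyc].
  apply: le_lt_trans (euc_dist_le_qh_dist domO' b0' (fO _ Ox) (fO _ Oy)) _.
  by apply: ke; apply: ltW; exact: ck.
- move=> p cp nOp; apply: (qh_embedding_cauchy domO wbO domO' b0' visO' f_qi f_cont).
  by split=> //; rewrite (interior_id _).1.
Qed.
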